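(* Consider the conditionally Gaussian model of the context (with $\psi$ bounded). Let $N\ge1$, let $z_0,z_0'\in\mathcal{X}^N$, and let $u_k$, $u_k'$ be the particle ensembles of the optimal particle filter with $N$ particles, initialized at $z_0$ and $z_0'$ respectively, both defined with the same observational data $\{y^\dagger_k\}_{k\ge1}$. Let $q^k(z_0,\cdot)$ and $q^k(z_0',\cdot)$ denote the laws of $u_k$ and $u'_k$ on $\mathcal{X}^N$ given the data. Then there exists $\mathfrak{z}_N\in(0,1)$ such that, almost surely with respect to the randomness generating $\{y^\dagger_k\}_{k\ge1}$, $$\limsup_{k\to\infty}\Bigl(d_{\rm TV}\bigl(q^k(z_0,\cdot),q^k(z_0',\cdot)\bigr)\Bigr)^{1/k}\ \le\ \mathfrak{z}_N .$$
   Context: $\mathcal{X}$ and $\mathcal{Y}$ are finite-dimensional Euclidean spaces. For symmetric positive definite $A$, $|\cdot|_A=|A^{-1/2}\cdot|$. The total variation metric on probability measures is $d_{\rm TV}(\mu,\nu)=\frac12\sup_{|h|\le1}|\mu(h)-\nu(h)|$, the supremum being over measurable functions bounded by $1$. Model. $\psi:\mathcal{X}\to\mathcal{X}$ is bounded (and measurable), $H:\mathcal{X}\to\mathcal{Y}$ is linear, and $$u_{k+1}=\psi(u_k)+\xi_k,\qquad y_{k+1}=Hu_{k+1}+\eta_{k+1},$$ with $\xi_k\sim N(0,\Sigma)$ i.i.d., $\eta_k\sim N(0,\Gamma)$ i.i.d., independent of each other and of the initial condition. Here $\Sigma=\sigma^2\Sigma_0$, $\Gamma=\gamma^2\Gamma_0$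 with $\Sigma_0,\Gamma_0$ strictly positive definite, $\sigma,\gamma\in(0,\infty)$, $r:=\sigma/\gamma$. Set $$C^{-1}=\Sigma^{-1}+H^*\Gamma^{-1}H,\quad S=H\Sigma H^*+\Gamma,\quad K=\Sigma H^*S^{-1}.$$ Fixed data. Fix $u_0^\dagger\in\mathcal{X}$ and positive semi-definite matrices $\Sigma_*,\Gamma_*$ on $\mathcal{X},\mathcal{Y}$, and let $$u^\dagger_{k+1}=\psi(u^\dagger_k)+r\gamma\,\xi^\dagger_k,\qquad y^\dagger_{k+1}=Hu^\dagger_{k+1}+\gamma\,\eta^\dagger_{k+1},$$ with $\xi^\dagger_k\sim N(0,\Sigma_* )$ i.i.d., $\eta^\dagger_k\sim N(0,\Gamma_* )$ i.i.d., the two sequences being independent. Optimal particle filter (OPF). In this statement $u_k=(u_k^{(1)},\dots,u_k^{(N)})\in\mathcal{X}^N$ denotes the particle ensemble. Given data $\{y_k\}$ (here $y_k=y_k^\dagger$), $$\widehat u_{k+1}^{(n)}=(I-KH)\psi(u_k^{(n)})+Ky_{k+1}+\zeta_k^{(n)},\quad \zeta_k^{(n)}\sim N(0,C)\ \text{i.i.d.},$$ $$u_{k+1}^{(n)}=\sum_{m=1}^N \mathbb{I}_{I_{k+1}^{(m)}}(r_{k+1}^{(n)})\,\widehat u_{k+1}^{(m)},\quad r_{k+1}^{(n)}\sim U(0,1)\ \text{i.i.d.},$$ with weights $$w_{k+1}^{(n),*}=\exp\bigl(-\tfrac12|y_{k+1}-H\psi(u_k^{(n)})|_S^2\bigr),\quad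 w_{k+1}^{(n)}=\frac{w_{k+1}^{(n),*}}{\sum_{m=1}^Nw_{k+1}^{(m),*}},$$ and intervals $I_{k+1}^{(m)}=[\alpha_{k+1}^{(m-1)},\alpha_{k+1}^{(m)})$, $\alpha_{k+1}^{(0)}=0$, $\alpha_{k+1}^{(m)}=\alpha_{k+1}^{(m-1)}+w_{k+1}^{(m)}$, $m=1,\dots,N$ (so the particles $u_{k+1}^{(n)}$ are resampled from $\{\widehat u_{k+1}^{(m)}\}$ with weights $w_{k+1}^{(m)}$). The variables $\zeta_k^{(n)}$, $r_k^{(n)}$ are independent of each other and of the data. Given the data, $u_k$ is an inhomogeneous Markov chain on $\mathcal{X}^N$ with one-step kernels $q_k$, and $q^k(z,\cdot)$ denotes the $k$-fold composition of $q_1,\dots,q_k$, i.e. the law of $u_k$ when $u_0=z$. *)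

(* Defs.v *)
From HB Require Import structures.
From mathcomp Require Import all_boot all_order all_algebra finmap.
From mathcomp Require Import all_classical all_reals all_analysis.

Set Implicit Arguments.
Unset Strict Implicit.
Unset Printing Implicit Defensive.

Import Order.TTheory GRing.Theory Num.Theory.
Import numFieldNormedType.Exports.

Local Open Scope classical_set_scope.
Local Open Scope ring_scope.

Section measurable_matrix.
Context {R : realType} (m n : nat).

Definition mx_coord (ij : 'I_m * 'I_n) (A : 'M[R]_(m, n)) : R := A ij.1 ij.2.

(* The coordinate sigma-algebra; in finite dimension it is the Borel
   sigma-algebra. *)
Definition mx_measurable : set (set 'M[R]_(m, n)) :=
  <<s \bigcup_ij preimage_set_system [set: 'M[R]_(m, n)] (mx_coord ij)
        measurable >>.

Let mx_measurable0 : mx_measurable set0.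
Proof. exact: sigma_algebra0. Qed.

Let mx_measurableC A : mx_measurable A -> mx_measurable (~` A).
Proof. exact: sigma_algebraC. Qed.

Let mx_measurable_bigcup (F : (set 'M[R]_(m, n))^nat) :
  (forall i, mx_measurable (F i)) -> mx_measurable (\bigcup_i (F i)).
Proof. exact: sigma_algebra_bigcup. Qed.

HB.instance Definition _ := @isMeasurable.Build default_measure_display
  'M[R]_(m, n) mx_measurable mx_measurable0 mx_measurableC
  mx_measurable_bigcup.

End measurable_matrix.

Section quadratic_forms.
Context {R : realType} {n : nat}.
Implicit Types A : 'M[R]_n.

Definition posdef A : Prop :=
  A^T = A /\ forall v : 'cV[R]_n, v != 0 -> 0 < (v^T *m A *m v) 0 0.

Definition possemidef A : Prop :=
  A^T = A /\ forall v : 'cV[R]_n, 0 <= (v^T *m A *m v) 0 0.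

(* |v|_A ^ 2 = <A^(-1/2) v, A^(-1/2) v> = <v, A^(-1) v> *)
Definition sqnorm_wrt A (v : 'cV[R]_n) : R := (v^T *m invmx A *m v) 0 0.

End quadratic_forms.

Section laws.
Context {R : realType}.

Definition std_gaussian n (g : set 'cV[R]_n -> \bar R) : Prop :=
  forall B : 'I_n -> set R, (forall i, measurable (B i)) ->
    g [set z | forall i, B i (z i 0)] =
    (\prod_(i < n) normal_prob 0 1 (B i))%E.

(* mu = N(0, Sigma), possibly degenerate: mu is the law of A Z, where Z is a
   standard Gaussian vector and A A^T = Sigma. *)
Definition gaussian n (Sigma : 'M[R]_n) (mu : set 'cV[R]_n -> \bar R) : Prop :=
  exists (A : 'M[R]_n) (g : probability 'cV[R]_n R),
    [/\ A *m A^T = Sigma, std_gaussian g &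
        forall E, measurable E -> mu E = pushforward g (mulmx A) E].

Definition uniform01 (mu : set R -> \bar R) : Prop :=
  forall E, measurable E -> mu E = uniform_prob (@ltr01 R) E.

Definition dTV d (T : measurableType d) (mu nu : set T -> \bar R) : \bar R :=
  ((2^-1)%:E * ereal_sup
    [set `| \int[mu]_x (h x)%:E - \int[nu]_x (h x)%:E | | h in
      [set h : T -> R | measurable_fun setT h /\
                        forall x, (`|h x| <= 1)%R] ])%E.

Definition mutually_independent d (T : measurableType d)
    (P : probability T R) (I : choiceType) (F : I -> set (set T)) : Prop :=
  forall (J : {fset I}) (E : I -> set T),
    (forall i, i \in J -> F i (E i)) ->
    P (\bigcap_(i in [set` J]) E i) = (\prod_(i <- J) P (E i))%E.

Definition sigma_gen d d' (T : measurableType d) (T' : measurableType d')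
    (X : T -> T') : set (set T) :=
  preimage_set_system setT X measurable.

End laws.

(* Noises driving the step from time k to time k + 1 are indexed by k: the
   values at k of xi, eta, zeta, rho stand for xi_k, eta_(k+1), zeta_k,
   r_(k+1). *)
Section truth.
Context {R : realType} {n p : nat}.
Context (psi : 'cV[R]_n -> 'cV[R]_n) (H : 'M[R]_(p, n)) (sigma gamma : R)
  (u0 : 'cV[R]_n).

Fixpoint truth (xi : nat -> 'cV[R]_n) (k : nat) : 'cV[R]_n :=
  if k is j.+1 then psi (truth xi j) + (sigma / gamma * gamma) *: xi j else u0.

(* The value at k is the observation at time k + 1. *)
Definition observation (xi : nat -> 'cV[R]_n) (eta : nat -> 'cV[R]_p)
    (k : nat) : 'cV[R]_p :=
  H *m truth xi k.+1 + gamma *: eta k.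

End truth.

Section particle_filter.
Context {R : realType} {n p : nat}.
Context (psi : 'cV[R]_n -> 'cV[R]_n) (H : 'M[R]_(p, n)) (Sigma : 'M[R]_n)
  (Gamma : 'M[R]_p).

Definition opf_C : 'M[R]_n := invmx (invmx Sigma + H^T *m invmx Gamma *m H).
Definition opf_S : 'M[R]_p := H *m Sigma *m H^T + Gamma.
Definition opf_K : 'M[R]_(n, p) := Sigma *m H^T *m invmx opf_S.

Context {N : nat}.
Implicit Types (y : 'cV[R]_p) (u : N.-tuple 'cV[R]_n) (zeta : 'I_N -> 'cV[R]_n)
  (rho : 'I_N -> R).

Definition opf_proposal y u zeta (m : 'I_N) : 'cV[R]_n :=
  (1%:M - opf_K *m H) *m psi (tnth u m) + opf_K *m y + zeta m.

Definition opf_rawweight y u (m : 'I_N) : R :=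
  expR (- (2^-1 * sqnorm_wrt opf_S (y - H *m psi (tnth u m)))).

Definition opf_weight y u (m : 'I_N) : R :=
  opf_rawweight y u m / \sum_(l < N) opf_rawweight y u l.

Definition opf_alpha y u (m : nat) : R :=
  \sum_(l < N | (l < m)%N) opf_weight y u l.

(* Particles are numbered from 0, so that the interval of particle m is
   [alpha m, alpha m.+1). *)
Definition opf_interval y u (m : 'I_N) : set R :=
  `[opf_alpha y u m, opf_alpha y u m.+1[%classic.

Definition opf_step y u zeta rho : N.-tuple 'cV[R]_n :=
  [tuple \sum_(m < N) \1_(opf_interval y u m) (rho i) *: opf_proposal y u zeta m
   | i < N].

Fixpoint opf (y : nat -> 'cV[R]_p) (z : N.-tuple 'cV[R]_n)
    (zeta : nat -> 'I_N -> 'cV[R]_n) (rho : nat -> 'I_N -> R) (k : nat) :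
    N.-tuple 'cV[R]_n :=
  if k is j.+1 then opf_step (y j) (opf y z zeta rho j) (zeta j) (rho j)
  else z.

(* q^k(z, .) for a frozen data sequence y; when the data are random and
   independent of zeta and rho, substituting them for y gives the conditional
   law of the ensemble given the data. *)
Definition opf_law d (T : measurableType d) (P : probability T R)
    (zeta : nat -> 'I_N -> T -> 'cV[R]_n) (rho : nat -> 'I_N -> T -> R)
    (y : nat -> 'cV[R]_p) (z : N.-tuple 'cV[R]_n) (k : nat) :
    set (N.-tuple 'cV[R]_n) -> \bar R :=
  pushforward P (fun t =>
    opf y z (fun j i => zeta j i t) (fun j i => rho j i t) k).

End particle_filter.

Definition noise_sigma (R : realType) (n p N : nat) d (T : measurableType d)
    (xi : nat -> T -> 'cV[R]_n) (eta : nat -> T -> 'cV[R]_p)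
    (zeta : nat -> 'I_N -> T -> 'cV[R]_n) (rho : nat -> 'I_N -> T -> R)
    (i : (nat + nat) + (nat * 'I_N + nat * 'I_N)) : set (set T) :=
  match i with
  | inl (inl k) => sigma_gen (xi k)
  | inl (inr k) => sigma_gen (eta k)
  | inr (inl (k, j)) => sigma_gen (zeta k j)
  | inr (inr (k, j)) => sigma_gen (rho k j)
  end.

(* Main.v *)
Require Import Defs.
From mathcomp Require Import all_boot all_order all_algebra finmap.
From mathcomp Require Import all_classical all_reals all_analysis.
From mathcomp Require Import measurable_realfun ring lra.
Set Implicit Arguments.
Unset Strict Implicit.
Unset Printing Implicit Defensive.
Import Order.TTheory GRing.Theory Num.Theory.
Import numFieldNormedType.Exports.
Local Open Scope classical_set_scope.
Local Open Scope ring_scope.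

(** For a fixed data sequence y the ensemble of the filter is a Markov chain
    driven by independent noises. The theorem is a quantitative Doeblin
    argument: every step whose observation is not too large contracts the total
    variation distance by a fixed factor, and almost surely such steps occur
    with positive frequency.

    Contraction under minorization (expectation_contraction). If the law of one
    step dominates, from every starting point, the same measure of mass e, then
    the conditional expectation of a function with values in [0, 1] takes its
    values in an interval of length 1 - e. After k steps the expectations from
    two starting points therefore differ by at most the product of the factors
    1 - e_j. The Markov property is obtained from the independence of the past
    of the filter and of its current noise (independent_blocks, a pi-lambda
    argument) and from the theorem of Fubini and Tonelli.

    Minorization for the filter (opf_minorization). When the observation lies in
    a ball of radius M, the boundedness of psi gives a lower bound w on all the
    weights. With probability at least w ^ N all the uniform variables fall
    below w, and then all the particles are copies of the proposal numbered 0,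
    a Gaussian vector with a fixed nondegenerate covariance and a mean in a fixed
    bounded set. The laws of such vectors dominate a common measure
    (gaussian_minorization): writing the covariance as A A^T, this is the
    corresponding statement for bounded translates of a standard Gaussian
    vector, proved one coordinate at a time (std_gaussian_shift).

    Frequency of the contracting steps (discount_ae_le). As psi is bounded, the
    observation is bounded on the event A_j that the two noises of the j-th step
    of the data are. The events A_j are independent with probabilities at least
    q > 0, so the product over j < k of 1 - e on A_j, and 1 elsewhere, has
    expectation at most (1 - e q) ^ k. The Markov inequality and the lemma of
    Borel and Cantelli bound this product almost surely, for k large, by b ^ k
    for any b > 1 - e q; here b = 1 - e q / 2. *)

(** * Measurability of matrix-valued maps and of the filter *)

Section matrix_measurability.
Context {R : realType} {d : measure_display} {T : measurableType d}.

Lemma measurable_mx_coord m n (i : 'I_m) (j : 'I_n) :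
  measurable_fun [set: 'M[R]_(m, n)] (fun A => A i j).
Proof.
move=> _ Y mY; apply: sub_sigma_algebra.
by exists (i, j) => //; exists Y.
Qed.

(** A matrix-valued map is measurable as soon as its entries are. *)
Lemma measurable_fun_mxP m n (f : T -> 'M[R]_(m, n)) :
  (forall i j, measurable_fun setT (fun t => f t i j)) ->
  measurable_fun setT f.
Proof.
move=> mf; apply: (measurability (\bigcup_(ij : 'I_m * 'I_n)
  preimage_set_system [set: 'M[R]_(m, n)] (mx_coord ij) measurable)) => //.
move=> _ [_ [[i j] _ [Y mY <-]] <-].
by rewrite setTI; exact: (mf i j).
Qed.

Lemma measurable_fun_coord m n (f : T -> 'M[R]_(m, n)) i j :
  measurable_fun setT f -> measurable_fun setT (fun t => f t i j).
Proof.
move=> mf; exact: (measurableT_comp (measurable_mx_coord i j) mf).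
Qed.

Lemma measurable_mxD m n (f g : T -> 'M[R]_(m, n)) :
  measurable_fun setT f -> measurable_fun setT g ->
  measurable_fun setT (fun t => f t + g t).
Proof.
move=> mf mg; apply: measurable_fun_mxP => i j.
under eq_fun do rewrite mxE.
by apply: measurable_funD; exact: measurable_fun_coord.
Qed.

Lemma measurable_mxZ m n (f : T -> 'M[R]_(m, n)) (a : T -> R) :
  measurable_fun setT a -> measurable_fun setT f ->
  measurable_fun setT (fun t => a t *: f t).
Proof.
move=> ma mf; apply: measurable_fun_mxP => i j.
under eq_fun do rewrite mxE.
by apply: measurable_funM => //; exact: measurable_fun_coord.
Qed.

Lemma measurable_mxM m n p (f : T -> 'M[R]_(m, n)) (g : T -> 'M[R]_(n, p)) :
  measurable_fun setT f -> measurable_fun setT g ->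
  measurable_fun setT (fun t => f t *m g t).
Proof.
move=> mf mg; apply: measurable_fun_mxP => i j.
under eq_fun do rewrite mxE.
by apply: measurable_sum => k; apply: measurable_funM;
  exact: measurable_fun_coord.
Qed.

Lemma measurable_mx_sum m n (I : Type) (s : seq I)
    (f : I -> T -> 'M[R]_(m, n)) :
  (forall i, measurable_fun setT (f i)) ->
  measurable_fun setT (fun t => \sum_(i <- s) f i t).
Proof.
move=> mf; elim: s => [|i s IHs].
  by under eq_fun do rewrite big_nil; exact: measurable_cst.
by under eq_fun do rewrite big_cons; exact: measurable_mxD.
Qed.

Lemma measurable_sqnorm_wrt n (A : 'M[R]_n) (f : T -> 'cV[R]_n) :
  measurable_fun setT f -> measurable_fun setT (fun t => sqnorm_wrt A (f t)).
Proof.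
move=> mf; apply: measurable_fun_coord; apply: measurable_mxM => //.
apply: measurable_mxM; last exact: measurable_cst.
apply: measurable_fun_mxP => i j; under eq_fun do rewrite mxE.
exact: measurable_fun_coord.
Qed.

End matrix_measurability.

Lemma measurable_mulmx {R : realType} m n p (A : 'M[R]_(m, n)) :
  measurable_fun [set: 'M[R]_(n, p)] (mulmx A).
Proof. by apply: measurable_mxM; [exact: measurable_cst|exact: measurable_id]. Qed.

Lemma measurable_tnth_fun {R : realType} {d : measure_display}
    {T : measurableType d} n N (f : T -> N.-tuple 'cV[R]_n) i :
  measurable_fun setT f -> measurable_fun setT (fun t => tnth (f t) i).
Proof. by move=> mf; exact: (measurableT_comp (measurable_tnth i) mf). Qed.

Section filter_measurability.
Context {R : realType} {n p N : nat}.
Context (psi : 'cV[R]_n -> 'cV[R]_n) (H : 'M[R]_(p, n)) (Sigma : 'M[R]_n)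
  (Gamma : 'M[R]_p).
Hypothesis psi_measurable : measurable_fun [set: 'cV[R]_n] psi.
Context {d : measure_display} {T : measurableType d}.
Implicit Types (u : T -> N.-tuple 'cV[R]_n).

Lemma opf_rawweight_gt0 y (u : N.-tuple 'cV[R]_n) m :
  0 < opf_rawweight psi H Sigma Gamma y u m.
Proof. exact: expR_gt0. Qed.

Lemma measurable_opf_rawweight y u m : measurable_fun setT u ->
  measurable_fun setT (fun t => opf_rawweight psi H Sigma Gamma y (u t) m).
Proof.
move=> mu; apply: measurableT_comp => //.
apply: measurable_funN; apply: measurable_funM => //.
apply: measurable_sqnorm_wrt; apply: measurable_mxD; first exact: measurable_cst.
apply: measurable_fun_mxP => i j; under eq_fun do rewrite mxE.
apply: measurable_funN; apply: measurable_fun_coord.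
apply: (measurableT_comp (measurable_mulmx _)).
by apply: (measurableT_comp psi_measurable); exact: measurable_tnth_fun.
Qed.

Lemma measurable_opf_weight y u m : measurable_fun setT u ->
  measurable_fun setT (fun t => opf_weight psi H Sigma Gamma y (u t) m).
Proof.
move=> mu; apply: measurable_funM; first exact: measurable_opf_rawweight.
(* the inverse is a real power, whose measurability is known *)
set s := fun t => _; rewrite (_ : s = (fun t => (\sum_(l < N)
    opf_rawweight psi H Sigma Gamma y (u t) l) `^ (-1))); last first.
  apply/funext => t; rewrite powR_inv1//.
  by apply: sumr_ge0 => l _; exact/ltW/opf_rawweight_gt0.
apply: (@measurableT_comp _ _ _ _ _ _ (fun x : R => x `^ (-1))).
  exact: measurable_powR.
by apply: measurable_sum => l; exact: measurable_opf_rawweight.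
Qed.

Lemma measurable_opf_alpha y u m : measurable_fun setT u ->
  measurable_fun setT (fun t => opf_alpha psi H Sigma Gamma y (u t) m).
Proof.
move=> mu; rewrite /opf_alpha.
under eq_fun do rewrite -big_filter.
by apply: measurable_sum => l; exact: measurable_opf_weight.
Qed.

Lemma measurable_opf_step y u (zeta : T -> 'I_N -> 'cV[R]_n)
    (rho : T -> 'I_N -> R) :
  measurable_fun setT u ->
  (forall i, measurable_fun setT (fun t => zeta t i)) ->
  (forall i, measurable_fun setT (fun t => rho t i)) ->
  measurable_fun setT
    (fun t => opf_step psi H Sigma Gamma y (u t) (zeta t) (rho t)).
Proof.
move=> mu mzeta mrho; apply/measurable_fun_tnthP => i.
rewrite /comp/=; under eq_fun do rewrite tnth_mktuple.
apply: measurable_mx_sum => m; apply: measurable_mxZ; last first.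
  apply: measurable_mxD => //; apply: measurable_mxD; last exact: measurable_cst.
  apply: (measurableT_comp (measurable_mulmx _)).
  by apply: (measurableT_comp psi_measurable); exact: measurable_tnth_fun.
(* the indicator of the interval as a conjunction of two comparisons *)
pose b t := (opf_alpha psi H Sigma Gamma y (u t) m <= rho t i) &&
  (rho t i < opf_alpha psi H Sigma Gamma y (u t) m.+1).
rewrite (_ : (fun t => _) = (fun t => if b t then 1 else 0)); last first.
  apply/funext => t; rewrite indicE.
  have -> : (rho t i \in opf_interval psi H Sigma Gamma y (u t) m) = b t.
    by apply/idP/idP; rewrite in_setE /b /opf_interval/= in_itv.
  by case: (b t).
apply: measurable_fun_ifT; [|exact: measurable_cst|exact: measurable_cst].
apply: measurable_and.
  by apply: measurable_fun_ler => //; exact: measurable_opf_alpha.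
by apply: measurable_fun_ltr => //; exact: measurable_opf_alpha.
Qed.

(** Only the noises of the steps before k matter; T may carry any sigma-algebra
    that makes them measurable. *)
Lemma measurable_opf y z (zeta : nat -> 'I_N -> T -> 'cV[R]_n)
    (rho : nat -> 'I_N -> T -> R) k :
  (forall j i, (j < k)%N -> measurable_fun setT (zeta j i)) ->
  (forall j i, (j < k)%N -> measurable_fun setT (rho j i)) ->
  measurable_fun setT (fun t => opf psi H Sigma Gamma y z
    (fun j i => zeta j i t) (fun j i => rho j i t) k).
Proof.
elim: k => [|k IHk] mzeta mrho; first exact: measurable_cst.
apply: measurable_opf_step => [|i|i]; [|exact: mzeta|exact: mrho].
by apply: IHk => j i jk; [apply: mzeta|apply: mrho]; exact: ltnW.
Qed.

End filter_measurability.

(** * Independence of blocks of sigma-algebras *)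

Section independence.
Context {R : realType} {d : measure_display} {T : measurableType d}.
Context (P : probability T R) (I : choiceType) (F : I -> set (set T)).
Hypothesis F_sigma : forall i, sigma_algebra setT (F i).
Hypothesis F_measurable : forall i, F i `<=` measurable.
Hypothesis F_indep : mutually_independent P F.

(** The product rule along a duplicate-free list of indices. *)
Lemma mutually_independent_seq (s : seq I) (E : I -> set T) : uniq s ->
  (forall i, i \in s -> F i (E i)) ->
  P (\bigcap_(i in [set` s]) E i) = (\prod_(i <- s) P (E i))%E.
Proof.
move=> us FE; pose J := [fset i in s]%fset.
have JE i : (i \in J) = (i \in s) by rewrite /J !inE.
have -> : [set` s] = [set` J] by apply/seteqP; split => i /=; rewrite JE.
rewrite F_indep; last by move=> i; rewrite JE; exact: FE.
apply: perm_big; apply: uniq_perm; [exact: fset_uniq|exact: us|exact: JE].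
Qed.

(** Finite intersections of events of the sigma-algebras indexed by D; events
    outside the finite index set J are irrelevant and can be taken total. *)
Definition cylinders (D : set I) : set (set T) :=
  [set A | exists (J : {fset I}) (E : I -> set T),
    [/\ [set` J] `<=` D, forall i, F i (E i) &
        A = \bigcap_(i in [set` J]) E i]].

Let FT i : F i setT.
Proof.
have [F0 FC _] := F_sigma i.
by rewrite -(setD0 setT); exact: FC.
Qed.

Let FI i : setI_closed (F i).
Proof.
move=> A B; rewrite -(sigma_algebra_id (F_sigma i)).
exact: (@measurableI _ (g_sigma_algebraType (F i))).
Qed.

Let cylinders_setI D : setI_closed (cylinders D).
Proof.
move=> _ _ [J [E [JD FE ->]]] [J' [E' [JD' FE' ->]]].
pose G i := (if i \in J then E i else setT) `&` (if i \in J' then E' i else setT).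
exists (J `|` J')%fset, G; split.
- by move=> i /=; rewrite inE => /orP[/JD|/JD'].
- by move=> i; apply: FI; case: ifP.
- apply/seteqP; split => t.
    move=> [JEt JE't] i /= _; split; first by case: ifPn => // /JEt.
    by case: ifPn => // /JE't.
  move=> Gt; split => i /= iJ.
    have : G i t by apply: Gt; rewrite /= inE iJ.
    by rewrite /G iJ => -[].
  have : G i t by apply: Gt; rewrite /= inE iJ orbT.
  by rewrite /G iJ => -[].
Qed.

Let cylindersT D : cylinders D setT.
Proof.
exists fset0, (fun=> setT); split => //.
by apply/seteqP; split => // t _ i /=; rewrite inE.
Qed.

Lemma bigcap_fset_measurable (J : {fset I}) (E : I -> set T) :
  (forall i, measurable (E i)) -> measurable (\bigcap_(i in [set` J]) E i).
Proof.
move=> mE; by apply: fin_bigcap_measurable => // i _; exact: mE.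
Qed.

Let cylinders_measurable D : cylinders D `<=` measurable.
Proof.
move=> _ [J [E [_ FE ->]]]; apply: bigcap_fset_measurable => i.
exact/F_measurable/FE.
Qed.

Let sub_cylinders D : \bigcup_(i in D) F i `<=` cylinders D.
Proof.
move=> A [i Di FA]; exists [fset i]%fset.
exists (fun j => if j == i then A else setT); split.
- by move=> j /=; rewrite inE => /eqP ->.
- by move=> j; case: eqP => [->|_].
- apply/seteqP; split => t.
    by move=> At j /=; rewrite inE => /eqP ->; rewrite eqxx.
  by move/(_ i) => /=; rewrite inE eqxx; exact.
Qed.

(* The product rule with B passes from a pi-system to the sigma-algebra that it
   generates, by uniqueness of finite measures. *)
Let extend (G : set (set T)) (B : set T) : setI_closed G -> G setT ->
  G `<=` measurable -> measurable B ->
  (forall A, G A -> P (A `&` B) = (P A * P B)%E) ->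
  forall A, <<s G >> A -> P (A `&` B) = (P A * P B)%E.
Proof.
move=> GI GT Gm mB GP A sA.
have PB : (fine (P B))%:E = P B by rewrite fineK// fin_num_measure.
pose c : {nonneg R} := NngNum (fine_ge0 (measure_ge0 P B)).
have cP X : mscale c P X = (P B * P X)%E by rewrite -PB.
rewrite muleC -cP; apply: (@g_sigma_algebra_measure_unique _ R T G Gm
  (fun=> setT) (fun=> GT) _ (mrestr P mB) (mscale c P) GI) => //.
- by rewrite bigcup_const//; exists 0%N.
- by move=> X GX; apply: (etrans (GP X GX)); rewrite muleC -PB.
- move=> _; apply: (@le_lt_trans _ _ 1%E); last exact: ltry.
  by apply: probability_le1; exact: measurableI.
Qed.

(** Disjoint blocks of mutually independent sigma-algebras generate independent
    sigma-algebras. *)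
Lemma independent_blocks (D1 D2 : set I) (A B : set T) :
  D1 `&` D2 = set0 ->
  <<s \bigcup_(i in D1) F i >> A -> <<s \bigcup_(i in D2) F i >> B ->
  P (A `&` B) = (P A * P B)%E.
Proof.
move=> D12 sA sB.
have {}sA : <<s cylinders D1 >> A by apply: sub_smallest2r sA;
  [exact: smallest_sigma_algebra|exact: sub_cylinders].
have {}sB : <<s cylinders D2 >> B by apply: sub_smallest2r sB;
  [exact: smallest_sigma_algebra|exact: sub_cylinders].
have gm D X : <<s cylinders D >> X -> measurable X.
  apply: smallest_sub; first exact: sigma_algebra_measurable.
  exact: cylinders_measurable.
apply: (extend (@cylinders_setI D1) (cylindersT D1)) sA => //.
  exact: (gm _ _ sB).
move=> {}A cA; rewrite setIC muleC.
apply: (extend (@cylinders_setI D2) (cylindersT D2)) sB => //.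
  exact: cylinders_measurable cA.
move=> {}B [J2 [E2 [JD2 FE2 ->]]]; case: cA => J1 [E1 [JD1 FE1 ->]].
have J12 i : i \in J1 -> i \in J2 -> False.
  by move=> iJ1 iJ2; rewrite -[False]/(set0 i) -D12; split; [exact: JD1|exact: JD2].
pose E i := if i \in J1 then E1 i else E2 i.
have E1E : \bigcap_(i in [set` J1]) E1 i = \bigcap_(i in [set` J1]) E i.
  by apply: eq_bigcapr => i /= iJ; rewrite /E iJ.
have E2E : \bigcap_(i in [set` J2]) E2 i = \bigcap_(i in [set` J2]) E i.
  apply: eq_bigcapr => i /= iJ; rewrite /E; case: ifPn => // iJ1.
  by case: (J12 i).
have FE i : F i (E i) by rewrite /E; case: ifP.
rewrite E1E E2E -bigcap_setU.
pose s := (J2 ++ J1 : seq I).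
have -> : [set` J2] `|` [set` J1] = [set` s].
  apply/seteqP; split => i /=; rewrite /s mem_cat; first by move=> [->|->]; rewrite ?orbT.
  by move/orP.
rewrite mutually_independent_seq// ?big_cat ?F_indep//=.
rewrite /s cat_uniq !fset_uniq/= andbT; apply/hasPn => i /= iJ1.
by apply/negP => iJ2; exact: (J12 i).
Qed.

End independence.

Section noise_sigma_algebra.
Context {R : realType} {n p N : nat} {d : measure_display} {T : measurableType d}.
Context {P : probability T R}.
Context (xi : nat -> {RV P >-> 'cV[R]_n}) (eta : nat -> {RV P >-> 'cV[R]_p})
    (zeta : nat -> 'I_N -> {RV P >-> 'cV[R]_n})
    (rho : nat -> 'I_N -> {RV P >-> R}).

Lemma sigma_gen_sigma d' (T' : measurableType d') (X : T -> T') :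
  sigma_algebra setT (sigma_gen X).
Proof. exact/sigma_algebra_preimage/sigma_algebra_measurable. Qed.

Lemma sigma_gen_measurable d' (T' : measurableType d') (X : T -> T') :
  measurable_fun setT X -> sigma_gen X `<=` measurable.
Proof. by move=> mX _ [Y mY <-]; exact: mX. Qed.

Lemma noise_sigma_sigma i : sigma_algebra setT (noise_sigma xi eta zeta rho i).
Proof. by case: i => [[k|k]|[[k j]|[k j]]]; exact: sigma_gen_sigma. Qed.

Lemma noise_sigma_measurable i : noise_sigma xi eta zeta rho i `<=` measurable.
Proof.
by case: i => [[k|k]|[[k j]|[k j]]]; apply: sigma_gen_measurable => //;
  exact: measurable_funP.
Qed.

End noise_sigma_algebra.

(** * Contraction of a Markov chain under minorization *)

Section independent_integral.
Context {R : realType} {d dS dV : measure_display} {T : measurableType d}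
  {S : measurableType dS} {V : measurableType dV}.
Context (P : probability T R) (X : T -> S) (W : T -> V).
Hypothesis mX : measurable_fun setT X.
Hypothesis mW : measurable_fun setT W.
Hypothesis XW : forall A B, measurable A -> measurable B ->
  P (X @^-1` A `&` W @^-1` B) = (P (X @^-1` A) * P (W @^-1` B))%E.

(** Independent variables can be integrated one after the other, the second one
    along an independent copy of the probability space. *)
Lemma independent_integral (f : (S * V)%type -> \bar R) :
  measurable_fun setT f -> (forall x, 0 <= f x)%E ->
  (\int[P]_t f (X t, W t) = \int[P]_t \int[P]_s f (X t, W s))%E.
Proof.
move=> mf f0.
pose X' : {RV P >-> S} := mfun_Sub (mem_set mX).
pose W' : {RV P >-> V} := mfun_Sub (mem_set mW).
have mXW : measurable_fun setT (fun t => (X t, W t)) by exact: measurable_fun_pair.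
pose XW' : {RV P >-> (S * V)%type} := mfun_Sub (mem_set mXW).
pose muX := distribution P X'; pose muW := distribution P W'.
have prodE A : measurable A -> (muX \x muW)%E A = distribution P XW' A.
  by apply: product_measure_unique => B C mB mC; exact: XW.
rewrite -[LHS](ge0_integral_distribution XW' mf f0).
transitivity (\int[muX \x muW]_x f x)%E.
  by apply: eq_measure_integral => A mA _; exact/esym/prodE.
rewrite fubini_tonelli1// /fubini_F.
have mfx x : measurable_fun setT (fun y => f (x, y)).
  by apply: (measurableT_comp mf); exact: pair1_measurable.
under eq_integral => x _ do rewrite (ge0_integral_distribution W' (mfx x) (fun y => f0 _)).
rewrite (ge0_integral_distribution X')//=; last first.
  by move=> x; apply: integral_ge0 => s _; exact: f0.
apply: (@measurable_fun_fubini_tonelli_F _ _ _ _ _ P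
  (fun x : (S * T)%type => f (x.1, W x.2))) => //.
apply: (measurableT_comp mf); apply: measurable_fun_pair => //.
exact: (measurableT_comp mW measurable_snd).
Qed.

End independent_integral.

Section markov_contraction.
Context {R : realType} {d dS dV : measure_display} {T : measurableType d}
  {S : measurableType dS} {V : measurableType dV}.
Context (P : probability T R) (step : nat -> (S * V)%type -> S)
  (W : nat -> T -> V).

(** The random dynamical system started at z and driven by the noises W: the
    k-th step applies step k to the present state and to W k. *)
Fixpoint chain (z : S) (k : nat) (t : T) : S :=
  if k is j.+1 then step j (chain z j t, W j t) else z.

Hypothesis mstep : forall k, measurable_fun setT (step k).
Hypothesis mW : forall k, measurable_fun setT (W k).

Lemma measurable_chain z k : measurable_fun setT (chain z k).
Proof.
elim: k => [|k IHk]; first exact: measurable_cst.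
by apply: measurableT_comp (mstep k) _; exact: measurable_fun_pair.
Qed.

Hypothesis chain_indep : forall z k A B, measurable A -> measurable B ->
  P (chain z k @^-1` A `&` W k @^-1` B) =
  (P (chain z k @^-1` A) * P (W k @^-1` B))%E.

Context (nu : nat -> {measure set S -> \bar R}) (e : nat -> R).
Hypothesis nuT : forall k, nu k setT = (e k)%:E.
Hypothesis e_lt1 : forall k, e k < 1.
Hypothesis minorization : forall k u E, measurable E ->
  (nu k E <= P [set t | E (step k (u, W k t))])%E.

Let integral_compl d' (T' : measurableType d') (mu : {measure set T' -> \bar R})
    (f : T' -> R) : measurable_fun setT f -> (forall x, 0 <= f x <= 1) ->
  (\int[mu]_x (f x)%:E + \int[mu]_x (1 - f x)%:E = mu setT)%E.
Proof.
move=> mf f01; rewrite -ge0_integralD//.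
- under eq_integral do rewrite -EFinD addrC subrK.
  by rewrite integral_cst// mul1e.
- by move=> x _; rewrite lee_fin; case/andP: (f01 x).
- exact/measurable_EFinP.
- by move=> x _; rewrite lee_fin subr_ge0; case/andP: (f01 x).
- by apply/measurable_EFinP; exact: measurable_funB.
Qed.

Let PT : (P : {measure set T -> \bar R}) setT = 1%E.
Proof. exact: probability_setT. Qed.

(** One-sided form; exchanging z and z' gives the other inequality. *)
Lemma expectation_contraction z z' k (h : S -> R) :
  measurable_fun setT h -> (forall x, 0 <= h x <= 1) ->
  (\int[P]_t (h (chain z k t))%:E <=
   \int[P]_t (h (chain z' k t))%:E + (\prod_(j < k) (1 - e j))%:E)%E.
Proof.
elim: k h => [|k IHk] h mh h01.
  rewrite big_ord0 /= !integral_cst// PT !mule1 lee_fin.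
  by move: (h01 z) (h01 z'); lra.
have mhstep : measurable_fun setT (h \o step k) by exact: measurableT_comp.
have mhW u : measurable_fun setT (fun t => h (step k (u, W k t))).
  apply: (measurableT_comp mhstep).
  by apply: measurable_fun_pair => //; exact: measurable_cst.
(* the conditional expectation of h given the present state *)
pose g u : \bar R := (\int[P]_s (h (step k (u, W k s)))%:E)%E.
have g0 u : (0 <= g u)%E.
  by apply: integral_ge0 => s _; rewrite lee_fin; case/andP: (h01 (step k (u, W k s))).
have mg : measurable_fun setT g.
  apply: (@measurable_fun_fubini_tonelli_F _ _ _ _ _ P
    (fun x : (S * T)%type => (h (step k (x.1, W k x.2)))%:E)).
    apply/measurable_EFinP; apply: (measurableT_comp mhstep).
    apply: measurable_fun_pair; first exact: measurable_fst.
    exact: (measurableT_comp (mW k) measurable_snd).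
  by move=> x; rewrite lee_fin; case/andP: (h01 (step k (x.1, W k x.2))).
have chainS y : (\int[P]_t (h (chain y k.+1 t))%:E = \int[P]_t g (chain y k t))%E.
  apply: (@independent_integral _ _ _ _ _ _ _ P (chain y k) (W k) _ (mW k)
    (chain_indep y k) (fun x => (h (step k x))%:E)).
  - exact: measurable_chain.
  - exact/measurable_EFinP.
  - by move=> x; rewrite lee_fin; case/andP: (h01 (step k x)).
(* the minorizing measure bounds the conditional expectation on both sides *)
have nu_le u (f : S -> R) : measurable_fun setT f -> (forall x, 0 <= f x) ->
    (\int[nu k]_x (f x)%:E <= \int[P]_s (f (step k (u, W k s)))%:E)%E.
  move=> mf f0.
  have mu : measurable_fun setT (fun s => step k (u, W k s)).
    apply: (measurableT_comp (mstep k)).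
    by apply: measurable_fun_pair => //; exact: measurable_cst.
  pose U : {RV P >-> S} := mfun_Sub (mem_set mu).
  have mf' : measurable_fun setT (EFin \o f) by exact/measurable_EFinP.
  rewrite -[leRHS](ge0_integral_distribution U mf'); last by move=> x; rewrite lee_fin.
  apply: ge0_le_measure_integral => //.
  by move=> E mE; exact: minorization.
have mh1 : measurable_fun setT (fun x => 1 - h x) by exact: measurable_funB.
pose A := (\int[nu k]_x (h x)%:E)%E; pose A' := (\int[nu k]_x (1 - h x)%:E)%E.
have A0 : (0 <= A)%E by apply: integral_ge0 => x _; rewrite lee_fin; case/andP: (h01 x).
have A'0 : (0 <= A')%E.
  by apply: integral_ge0 => x _; rewrite lee_fin subr_ge0; case/andP: (h01 x).
have AA' : (A + A' = (e k)%:E)%E by rewrite integral_compl.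
have Afin : A \is a fin_num.
  by rewrite ge0_fin_numE// (le_lt_trans _ (ltry (e k)))// -AA' leeDl.
have A'fin : A' \is a fin_num.
  by rewrite ge0_fin_numE// (le_lt_trans _ (ltry (e k)))// -AA' leeDr.
have gbound u : g u \is a fin_num /\ fine A <= fine (g u) <= fine A + (1 - e k).
  pose g' := (\int[P]_s (1 - h (step k (u, W k s)))%:E)%E.
  have g'0 : (0 <= g')%E.
    by apply: integral_ge0 => s _; rewrite lee_fin subr_ge0;
       case/andP: (h01 (step k (u, W k s))).
  have gg' : (g u + g' = 1%:E)%E.
    rewrite integral_compl ?PT// => s; exact: h01.
  have gfin : g u \is a fin_num.
    by rewrite ge0_fin_numE// (le_lt_trans _ (ltry 1))// -gg' leeDl.
  have g'fin : g' \is a fin_num.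
    by rewrite ge0_fin_numE// (le_lt_trans _ (ltry 1))// -gg' leeDr.
  have Ag : (A <= g u)%E by apply: nu_le => // x; case/andP: (h01 x).
  have Ag' : (A' <= g')%E.
    by apply: (nu_le u (fun x => 1 - h x)) => // x; rewrite subr_ge0; case/andP: (h01 x).
  split => //; move: AA' gg' Ag Ag'.
  rewrite -(fineK Afin) -(fineK A'fin) -(fineK gfin) -(fineK g'fin) -!EFinD !lee_fin.
  by move=> [AA'] [gg']; lra.
have e1 : 0 < 1 - e k by rewrite subr_gt0.
(* rescaled to [0, 1], the conditional expectation falls under the induction
   hypothesis *)
pose h' u := (fine (g u) - fine A) / (1 - e k).
have h'01 u : 0 <= h' u <= 1.
  have [_ /andP[gu1 gu2]] := gbound u.
  by rewrite /h' ler_pdivlMr// ler_pdivrMr//; apply/andP; split; lra.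
have mh' : measurable_fun setT h'.
  apply: measurable_funM => //; apply: measurable_funB => //.
  exact: (measurableT_comp _ mg).
have gE u : g u = ((fine A)%:E + (1 - e k)%:E * (h' u)%:E)%E.
  have [gfin _] := gbound u.
  rewrite -[LHS](fineK gfin) -EFinM -EFinD; congr (_%:E).
  by rewrite /h' mulrC divfK ?gt_eqF//; lra.
have chainSE y : (\int[P]_t (h (chain y k.+1 t))%:E =
    (fine A)%:E + (1 - e k)%:E * \int[P]_t (h' (chain y k t))%:E)%E.
  rewrite chainS; under eq_integral do rewrite gE.
  have mh'c : measurable_fun setT (fun t => h' (chain y k t)).
    exact: (measurableT_comp mh' (measurable_chain _ _)).
  have h'c0 t : (0 <= (h' (chain y k t))%:E)%E.
    by rewrite lee_fin; case/andP: (h'01 (chain y k t)).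
  rewrite ge0_integralD//.
  - by rewrite integral_cst// PT mule1 ge0_integralZl_EFin// ?ltW//;
      exact/measurable_EFinP.
  - by move=> t _; rewrite lee_fin fine_ge0.
  - by move=> t _; rewrite mule_ge0// lee_fin ltW.
  - by apply/measurable_EFinP; exact: measurable_funM.
have I0 : (0 <= \int[P]_t (h' (chain z' k t))%:E)%E.
  by apply: integral_ge0 => t _; rewrite lee_fin; case/andP: (h'01 (chain z' k t)).
have p0 : 0 <= \prod_(j < k) (1 - e j).
  by apply: prodr_ge0 => j _; rewrite subr_ge0 ltW.
rewrite !chainSE big_ord_recr/= -addeA leeD2l// [_ * (1 - e k)]mulrC EFinM.
rewrite -ge0_muleDr ?lee_fin//.
by apply: lee_wpmul2l; [rewrite lee_fin ltW|exact: IHk].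
Qed.

End markov_contraction.

(** * From test functions to total variation *)

Section dTV_bound.
Context {R : realType} {d dS : measure_display} {T : measurableType d}
  {S : measurableType dS}.
Context (P : probability T R).

Let PT : (P : {measure set T -> \bar R}) setT = 1%E.
Proof. exact: probability_setT. Qed.

(** In the total variation distance of two laws it suffices to compare the
    expectations of functions with values in the unit interval. *)
Lemma dTV_pushforward_le (X X' : T -> S) (c : R) :
  measurable_fun setT X -> measurable_fun setT X' ->
  (forall h : S -> R, measurable_fun setT h -> (forall x, 0 <= h x <= 1) ->
     (\int[P]_t (h (X t))%:E <= \int[P]_t (h (X' t))%:E + c%:E)%E /\
     (\int[P]_t (h (X' t))%:E <= \int[P]_t (h (X t))%:E + c%:E)%E) ->
  (dTV (pushforward P X) (pushforward P X') <= c%:E)%E.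
Proof.
move=> mX mX' hc.
have half2 : (2^-1 * (2 * c))%R = c by rewrite mulrA mulVf ?mul1r// pnatr_eq0.
rewrite /dTV -[in leRHS]half2 [in leRHS]EFinM.
apply: lee_wpmul2l; first by rewrite lee_fin.
apply: ge_ereal_sup => _ [h [mh h1] <-].
(* maps [-1, 1] onto [0, 1] *)
pose h' x := (h x + 1) / 2.
have mh' : measurable_fun setT h'.
  by apply: measurable_funM => //; exact: measurable_funD.
have h'01 x : 0 <= h' x <= 1.
  by move: (h1 x); rewrite ler_norml /h' => /andP[h0 h2]; apply/andP; split; lra.
have integ (Y : T -> S) : measurable_fun setT Y ->
    exists2 r : R, (\int[P]_t (h' (Y t))%:E = r%:E)%E &
      (\int[pushforward P Y]_x (h x)%:E = (2 * r - 1)%:E)%E.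
  move=> mY.
  have mh'Y : measurable_fun setT (fun t => h' (Y t)) by exact: measurableT_comp.
  have ih'Y : P.-integrable setT (EFin \o (fun t => h' (Y t))).
    apply: measurable_bounded_integrable => //; first by rewrite PT ltry.
    exists 1; split; first exact: num_real.
    move=> x x1 t _ /=; move: (h'01 (Y t)) => /andP[h0 h2].
    by rewrite ger0_norm// (le_trans h2)// ltW.
  have fin := integrable_fin_num measurableT ih'Y.
  exists (fine (\int[P]_t (h' (Y t))%:E)%E); first by rewrite fineK.
  have hE : EFin \o h \o Y = (fun t => 2%:E * (h' (Y t))%:E - 1%:E)%E.
    apply/funext => t /=; rewrite -EFinM -EFinB; congr (_%:E).
    by rewrite /h'; lra.
  have i2 : P.-integrable setT (fun t => 2%:E * (h' (Y t))%:E)%E.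
    exact: integrableZl ih'Y.
  have i1 : P.-integrable setT (fun t => 1%:E : \bar R).
    by apply: finite_measure_integrable_cst.
  have ihY : P.-integrable setT ((EFin \o h) \o Y) by rewrite hE; exact: integrableB.
  have mhE : measurable_fun setT (EFin \o h) by exact/measurable_EFinP.
  rewrite (integral_pushforward mY mhE ihY measurableT) preimage_setT hE.
  rewrite integralB//= integralZl//= integral_cst// PT mule1.
  by rewrite EFinB EFinM fineK.
have [r Er hr] := integ X mX; have [r' Er' hr'] := integ X' mX'.
have [c1 c2] := hc h' mh' h'01.
move: c1 c2; rewrite Er Er' -!EFinD !lee_fin => c1 c2.
rewrite hr hr' -EFinB /= lee_fin ler_norml; apply/andP; split; lra.
Qed.

End dTV_bound.

(** * Translates of Gaussian laws *)

Section normal_shift.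
Context {R : realType}.
Local Notation mu := (@lebesgue_measure R).

Lemma measurable_shift (b : R) : measurable_fun setT (fun x : R => x + b).
Proof. exact: measurable_funD. Qed.

Lemma lebesgue_measure_shift (b : R) (A : set R) : measurable A ->
  mu [set x | A (x + b)] = mu A.
Proof.
move=> mA.
apply/esym.
apply: (lebesgue_measure_unique
  (mu := pushforward mu ((fun x => x + b) : _ -> measurableTypeR R))) => //=.
  exact: measurable_shift.
move=> _ _ [[x y] _ <-]; rewrite /pushforward.
have -> : (fun x : R => x + b) @^-1` `]x, y]%classic = `]x - b, y - b]%classic.
  by apply/seteqP; split => z /=; rewrite !in_itv/= ltrBlDr lerBrDr.
rewrite !lebesgue_measure_itv/= !lte_fin ltrD2r; case: ifP => // _.
by rewrite -!EFinB; congr (_%:E); lra.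
Qed.

Lemma integral_shift (b : R) (f : R -> \bar R) : measurable_fun setT f ->
  (forall x, 0 <= f x)%E ->
  (\int[mu]_x f (x + b)%R = \int[mu]_x f x)%E.
Proof.
move=> mf f0.
rewrite -[in LHS](preimage_setT ((fun x => x + b) : _ -> measurableTypeR R)).
rewrite -[LHS]ge0_integral_pushforward//=; last exact: measurable_shift.
apply: eq_measure_integral; first exact: measurable_shift.
by move=> mb A mA _; exact: lebesgue_measure_shift.
Qed.

Lemma normal_pdf01 (x : R) :
  normal_pdf 0 1 x = normal_peak (1:R) * expR (- (x ^+ 2 / 2)).
Proof.
rewrite normal_pdfE ?oner_eq0// /normal_fun subr0 expr1n mulNr.
by rewrite -mulr_natr mul1r.
Qed.

(** The factor lost when comparing, on [-1, 1], a standard normal law with its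
    translates by at most b. *)
Definition shift_factor (b : R) : R := expR (- ((1 + b) ^+ 2 / 2)).

Lemma shift_factor_gt0 b : 0 < shift_factor b.
Proof. exact: expR_gt0. Qed.

Lemma shift_factor_le1 b : shift_factor b <= 1.
Proof. by rewrite -[leRHS]expR0 ler_expR oppr_le0 divr_ge0// sqr_ge0. Qed.

Lemma normal_prob_shift (B b : R) (E : set R) : `|b| <= B -> measurable E ->
  ((shift_factor B)%:E * normal_prob 0 1 (E `&` `[(-1)%R, 1%R]) <=
   normal_prob 0 1 [set x | E (x + b)%R])%E.
Proof.
move=> bB mE.
have mpdf : measurable_fun setT (fun x : R => (normal_pdf 0 1 x)%:E).
  by apply/measurable_EFinP; exact: measurable_normal_pdf.
have pdf0 x : (0 <= (normal_pdf (0:R) 1 x)%:E)%E by rewrite lee_fin normal_pdf_ge0.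
pose f (x : R) : \bar R := ((normal_pdf 0 1 (x - b))%:E * (\1_E x)%:E)%E.
have mf : measurable_fun setT f.
  apply/measurable_EFinP/measurable_funM; last exact: measurable_indic.
  apply: (measurableT_comp (measurable_normal_pdf _ _)).
  exact: measurable_shift.
have f0 x : (0 <= f x)%E by rewrite mule_ge0// lee_fin.
have -> : (normal_prob 0 1 [set x | E (x + b)%R] = \int[mu]_x f x)%E.
  rewrite -(integral_shift b)// /normal_prob integral_mkcond.
  apply: eq_integral => x _; rewrite /f addrK patchE indicE.
  have -> : (x \in [set x | E (x + b)]) = (x + b \in E).
    by apply/idP/idP; rewrite !in_setE.
  by case: ifP; rewrite ?mule1 ?mule0.
pose g := (fun x : R => (normal_pdf 0 1 x)%:E) \_ (E `&` `[(-1)%R, 1%R]).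
have g0 x : (0 <= g x)%E by rewrite /g patchE; case: ifP.
have mg : measurable_fun setT g.
  apply/(measurable_restrictT _ _).1; first exact: measurableI.
  exact: measurable_funTS.
rewrite /normal_prob integral_mkcond -/g -ge0_integralZl_EFin//; last first.
  exact/ltW/shift_factor_gt0.
apply: ge0_le_integral => //.
- by move=> x _; apply: mule_ge0 => //; rewrite lee_fin ltW// shift_factor_gt0.
- by apply: emeasurable_funM => //; exact: measurable_cst.
move=> x _; rewrite /g patchE; case: ifPn; last by rewrite mule0.
rewrite in_setE => -[Ex]; rewrite /= in_itv/= => /andP[x1 x2].
rewrite /f indicE mem_set// mule1 -EFinM lee_fin !normal_pdf01 mulrCA.
apply: ler_wpM2l; first exact: normal_peak_ge0.
apply: (@le_trans _ _ (shift_factor B)).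
  apply: ler_piMr; first exact/ltW/shift_factor_gt0.
  by rewrite -[leRHS]expR0 ler_expR oppr_le0 divr_ge0// sqr_ge0.
rewrite ler_expR lerN2 ler_pM2r//.
by move: bB; rewrite ler_norml => /andP[b1 b2]; nra.
Qed.

Lemma normal_prob_itv_gt0 : (0 < normal_prob (0:R) 1 `[(-1)%R, 1%R])%E.
Proof.
have mpdf : measurable_fun setT (fun x : R => (normal_pdf 0 1 x)%:E).
  by apply/measurable_EFinP; exact: measurable_normal_pdf.
pose c := normal_peak (1:R) * expR (- (2^-1)).
have c0 : 0 < c by rewrite mulr_gt0 ?expR_gt0// normal_peak_gt0// oner_eq0.
apply: (@lt_le_trans _ _ (\int[mu]_(x in `[(-1)%R, 1%R]) c%:E)%E).
  rewrite integral_cst//= lebesgue_measure_itv/= lte_fin.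
  by rewrite ifT ?mule_gt0// ?lte_fin// -?EFinB ?lte_fin; lra.
apply: ge0_le_integral => //=.
- by move=> x _; rewrite lee_fin ltW.
- exact: measurable_funTS.
move=> x; rewrite in_itv/= => /andP[x1 x2].
rewrite lee_fin normal_pdf01 ler_wpM2l ?normal_peak_ge0// ler_expR lerN2.
by rewrite -[leRHS]mul1r ler_pM2r//; nra.
Qed.

End normal_shift.

Section sup_balls.
Context {R : realType} {n : nat}.

Lemma measurable_coord_le (i : 'I_n) (r : R) :
  measurable [set z : 'cV[R]_n | `|z i 0| <= r].
Proof.
rewrite -[X in measurable X]setTI.
rewrite (_ : [set z : 'cV[R]_n | _] = (fun z : 'cV[R]_n => z i 0) @^-1` `[- r, r]).
  exact: measurable_mx_coord.
by apply/seteqP; split => z /=; rewrite in_itv/= ler_norml.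
Qed.

(** The ball of radius r for the maximum norm. *)
Definition sup_ball (r : R) : set 'cV[R]_n := [set z | forall i, `|z i 0| <= r].

Lemma measurable_sup_ball (r : R) : measurable (sup_ball r).
Proof.
have -> : sup_ball r = \bigcap_(i in [set: 'I_n]) [set z : 'cV[R]_n | `|z i 0| <= r].
  by apply/seteqP; split => z //= Bz i; [move=> _; exact: Bz|exact: Bz].
by apply: fin_bigcap_measurable => // i _; exact: measurable_coord_le.
Qed.

End sup_balls.

Section std_gaussian.
Context {R : realType} {n : nat}.
Local Notation N01 := (@normal_prob R 0 1).

(** Products of measurable sets, a pi-system generating the sigma-algebra. *)
Definition boxes : set (set 'cV[R]_n) :=
  [set X | exists2 B : 'I_n -> set R, (forall i, measurable (B i)) &
           X = [set z : 'cV[R]_n | forall i, B i (z i 0)]].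

Lemma boxes_measurable : boxes `<=` measurable.
Proof.
move=> _ [B mB ->].
have -> : [set z : 'cV[R]_n | forall i, B i (z i 0)] =
    \bigcap_(i in [set: 'I_n]) [set z | B i (z i 0)].
  by apply/seteqP; split => z //= Bz i; [move=> _; exact: Bz|exact: Bz].
apply: fin_bigcap_measurable => // i _.
by rewrite -[X in measurable X]setTI; exact: (measurable_mx_coord i 0).
Qed.

Lemma boxes_setI : setI_closed boxes.
Proof.
move=> _ _ [B mB ->] [B' mB' ->]; exists (fun i => B i `&` B' i).
  by move=> i; exact: measurableI.
apply/seteqP; split => z /=; first by move=> [Bz B'z] i.
by move=> BB'z; split => i; case: (BB'z i).
Qed.

Lemma boxes_generate : measurable `<=` <<s boxes >>.
Proof.
apply: sub_smallest2r; first exact: smallest_sigma_algebra.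
move=> _ [[i j] _ [B mB <-]]; exists (fun k => if k == i then B else setT).
  by move=> k; case: ifP.
apply/seteqP; split => z /=; rewrite (ord1 j).
  by move=> [_ Bz] k; case: eqP => // ->.
by move=> /(_ i); rewrite eqxx.
Qed.

(** A finite measure is determined by its values on products. *)
Lemma measure_cV_unique (m m' : {measure set 'cV[R]_n -> \bar R}) :
  (m setT < +oo)%E -> (forall X, boxes X -> m X = m' X) -> forall X, measurable X -> m X = m' X.
Proof.
move=> mT mm' X mX.
have bT : boxes setT by exists (fun=> setT) => //; apply/seteqP; split.
apply: (@g_sigma_algebra_measure_unique _ R _ boxes boxes_measurable
  (fun=> setT) (fun=> bT) _ m m' boxes_setI) => //.
- by rewrite bigcup_const//; exists 0%N.
- exact: boxes_generate.
Qed.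

(** The vector v with its i-th coordinate replaced. *)
Definition set_coord (i : 'I_n) (vx : ('cV[R]_n * R)%type) : 'cV[R]_n :=
  \col_j (if j == i then vx.2 else vx.1 j 0).

Lemma measurable_set_coord i :
  measurable_fun [set: ('cV[R]_n * measurableTypeR R)%type] (set_coord i).
Proof.
apply: measurable_fun_mxP => j k; under eq_fun do rewrite mxE.
case: (j == i); first exact: measurable_snd.
exact: (measurableT_comp (measurable_mx_coord j 0) measurable_fst).
Qed.

Context (g : probability 'cV[R]_n R).
Hypothesis g_std : std_gaussian g.

(** Replacing one coordinate by an independent standard normal variable does
    not change the law of a standard Gaussian vector. *)
Lemma std_gaussian_resample i E : measurable E ->
  g E = (\int[g]_v N01 [set x | E (set_coord i (v, x))])%E.
Proof.
move=> mE.
transitivity (pushforward (g \x N01)%E (set_coord i) E); last first.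
  rewrite /pushforward /product_measure1 /=.
  apply: eq_integral => v _ /=; congr (N01 _).
  by apply/seteqP; split => x /=; rewrite /xsection/= in_setE.
apply: (measure_cV_unique (m' := pushforward (g \x N01)%E (set_coord i))) => //.
  exact: measurable_set_coord.
- by rewrite -ge0_fin_numE ?fin_num_measure.
move=> mPhi _ [B mB ->].
pose B' (j : 'I_n) := if j == i then setT else B j.
have mB' j : measurable (B' j) by rewrite /B'; case: ifP.
have preE : set_coord i @^-1` [set z : 'cV[R]_n | forall j, B j (z j 0)] =
    [set z : 'cV[R]_n | forall j, B' j (z j 0)] `*` B i.
  apply/seteqP; split => [[v x]|[v x]] /=.
    move=> Bvx; split => [j|].
      by rewrite /B'; case: ifPn => // ji; have := Bvx j; rewrite mxE (negbTE ji).
    by have := Bvx i; rewrite mxE eqxx.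
  move=> [B'v Bx] j; rewrite mxE; case: eqP => [->//|/eqP ji].
  by have := B'v j; rewrite /B' (negbTE ji).
rewrite [RHS](congr1 (g \x N01)%E preE).
have mbox : measurable [set z : 'cV[R]_n | forall j, B' j (z j 0)].
  by apply: boxes_measurable; exists B'.
rewrite product_measure1E//; last exact: mB.
have gE (A : 'I_n -> set R) : (forall j, measurable (A j)) ->
    (g : {measure set 'cV[R]_n -> \bar R}) [set z : 'cV[R]_n | forall j, A j (z j 0)] =
    (\prod_(j < n) N01 (A j))%E by exact: g_std.
rewrite !gE// [in RHS](bigD1 i)//= [in LHS](bigD1 i)//= {1}/B' eqxx.
rewrite probability_setT mul1e muleC; congr (_ * _)%E.
by apply: eq_bigr => j ji; rewrite /B' (negbTE ji).
Qed.

Lemma measurable_shift_cV (b : 'cV[R]_n) E : measurable E ->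
  measurable [set z : 'cV[R]_n | E (z + b)].
Proof.
move=> mE; rewrite -[X in measurable X]setTI.
by apply: (measurable_mxD (@measurable_id _ _ _) (measurable_cst b)).
Qed.

(** Translation along one coordinate: integrate the one-dimensional comparison
    over the other coordinates. *)
Lemma std_gaussian_shift_coord (B c : R) i E : `|c| <= B -> measurable E ->
  ((shift_factor B)%:E * g (E `&` [set z : 'cV[R]_n | (`|z i 0| <= 1)%R]) <=
   g [set z : 'cV[R]_n | E (z + c *: delta_mx i 0)%R])%E.
Proof.
move=> cB mE.
have mE1 := measurableI _ _ mE (measurable_coord_le i 1).
have mEc := measurable_shift_cV (c *: delta_mx i 0) mE.
have mx A : measurable A ->
    measurable_fun setT (fun v => N01 [set x | A (set_coord i (v, x))]).
  move=> mA.
  have mA' : measurable ((set_coord i @^-1` A) : set ('cV[R]_n * measurableTypeR R)%type).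
    rewrite -[X in measurable X]setTI.
    exact: measurable_set_coord.
  have := measurable_fun_xsection N01 mA'.
  congr (measurable_fun _ _); apply/funext => v /=; congr (N01 _).
  by apply/seteqP; split => x /=; rewrite /xsection/= in_setE.
rewrite (std_gaussian_resample i mE1) (std_gaussian_resample i mEc).
rewrite -ge0_integralZl_EFin//; last 2 first.
- exact: mx.
- exact/ltW/shift_factor_gt0.
apply: ge0_le_integral => //.
- by move=> v _; apply: mule_ge0 => //; rewrite lee_fin ltW// shift_factor_gt0.
- by apply: emeasurable_funM; [exact: measurable_cst|exact: mx].
- exact: mx.
move=> v _.
have mEv : measurable [set x | E (set_coord i (v, x))].
  rewrite -[X in measurable X]setTI.
  exact: (measurableT_comp (measurable_set_coord i) (pair1_measurable v)).
have := normal_prob_shift cB mEv; congr (_ * _ <= _)%E.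
  congr (N01 _); apply/seteqP; split => x /=; rewrite in_itv/= ?ler_norml mxE eqxx//.
congr (N01 _); apply/seteqP; split => x /=; congr E;
  by apply/colP => j; rewrite !mxE; case: eqP => _; rewrite ?mulr1 ?mulr0 ?addr0.
Qed.

Lemma std_gaussian_unit_box :
  g (sup_ball 1) = ((fine (N01 `[(-1)%R, 1%R])) ^+ n)%:E.
Proof.
have -> : sup_ball 1 = [set z : 'cV[R]_n | forall i, (`[-1, 1]%classic : set R) (z i 0)].
  by apply/seteqP; split => z /= zb i; move: (zb i); rewrite /= in_itv/= ler_norml.
have NE : N01 `[(-1)%R, 1%R] = (fine (N01 `[(-1)%R, 1%R]))%:E.
  by rewrite fineK// fin_num_measure.
apply: etrans (@g_std (fun=> `[-1, 1]%classic) (fun=> measurable_itv _)) _.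
by under eq_bigr do rewrite NE; rewrite prodEFin prodr_const card_ord.
Qed.

(** Translates of a standard Gaussian vector by vectors of a bounded set have a
    common component, on the unit box. *)
Lemma std_gaussian_shift (B : R) (b : 'cV[R]_n) E :
  (forall i, `|b i 0| <= B) -> measurable E ->
  ((shift_factor B ^+ n)%:E * g (E `&` sup_ball 1) <= g [set z : 'cV[R]_n | E (z + b)%R])%E.
Proof.
move=> bB.
(* the first m coordinates of b, and the box restricting these coordinates *)
pose bm m : 'cV[R]_n := \col_j (if (j < m)%N then b j 0 else 0).
pose box m : set 'cV[R]_n := [set z : 'cV[R]_n | forall i : 'I_n, (i < m)%N -> `|z i 0| <= 1].
have mbox m : measurable (box m).
  have -> : box m = \bigcap_(i in [set i : 'I_n | (i < m)%N]) [set z : 'cV[R]_n | `|z i 0| <= 1].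
    by apply/seteqP; split.
  by apply: fin_bigcap_measurable => // i _; exact: measurable_coord_le.
suff main m : (m <= n)%N -> forall E, measurable E ->
    ((shift_factor B ^+ m)%:E * g (E `&` box m) <= g [set z : 'cV[R]_n | E (z + bm m)%R])%E.
  move=> mE; have := main n (leqnn n) E mE; congr (_ * g _ <= g _)%E.
    by congr (_ `&` _); apply/seteqP; split => z /= zb i => [|_]; apply: zb.
  apply/seteqP; split => z /=; congr E;
  by congr (_ + _); apply/colP => i; rewrite mxE ltn_ord.
elim: m => [_|m IHm mn] {}E mE.
  rewrite expr0 mul1e; apply: le_measure; rewrite ?inE.
  - exact: measurableI.
  - exact: measurable_shift_cV.
  move=> z [Ez _] /=; rewrite (_ : bm 0%N = 0) ?addr0//.
  by apply/colP => i; rewrite !mxE.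
pose i := Ordinal mn.
have bmS : bm m.+1 = bm m + b i 0 *: delta_mx i 0.
  apply/colP => j; rewrite !mxE ltnS leq_eqVlt -(inj_eq val_inj) /=.
  case: (ltngtP j m) => jm /=; rewrite ?mulr0 ?addr0//.
  by rewrite mulr1 add0r; congr (b _ 0); exact: val_inj.
pose E' := [set w | E (w + b i 0 *: delta_mx i 0)].
have mE' : measurable E' by exact: measurable_shift_cV.
have boxS : E `&` box m.+1 = (E `&` box m) `&` [set z : 'cV[R]_n | `|z i 0| <= 1].
  apply/seteqP; split => z /=.
    move=> [Ez zb]; split; last exact: zb.
    by split => // j jm; apply: zb; exact: ltnW.
  move=> [[Ez zb] zi]; split => // j; rewrite ltnS leq_eqVlt => /orP[/eqP jm|/zb//].
  by rewrite (_ : j = i)//; exact: val_inj.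
have step1 : ((shift_factor B)%:E * g (E `&` box m.+1) <= g (E' `&` box m))%E.
  rewrite boxS; apply: le_trans (std_gaussian_shift_coord i (bB i) _) _.
    exact: measurableI.
  apply: le_measure; rewrite ?inE.
  - exact: (measurable_shift_cV _ (measurableI _ _ mE (mbox m))).
  - exact: measurableI.
  move=> z /= [Ez zb]; split => // j jm.
  have := zb j jm; rewrite !mxE -(inj_eq val_inj)/= (ltn_eqF jm)/=.
  by rewrite mulr0 addr0.
rewrite exprSr EFinM -muleA.
apply: (@le_trans _ _ ((shift_factor B ^+ m)%:E * g (E' `&` box m))%E).
  by apply: lee_wpmul2l => //; rewrite lee_fin exprn_ge0// ltW// shift_factor_gt0.
apply: le_trans (IHm (ltnW mn) E' mE') _.
rewrite bmS (_ : [set z : 'cV[R]_n | E' (z + bm m)] =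
  [set z : 'cV[R]_n | E (z + (bm m + b i 0 *: delta_mx i 0))])//.
by apply/seteqP; split => z; rewrite /E'/= addrA.
Qed.

End std_gaussian.

(** * Matrix bounds and positive definite matrices *)

Section matrix_bounds.
Context {R : realType}.

Lemma mulmx_bound m n (A : 'M[R]_(m, n)) (v : 'cV[R]_n) (a b : R) :
  (forall i j, `|A i j| <= a) -> (forall j, `|v j 0| <= b) ->
  forall i, `|(A *m v) i 0| <= n%:R * (a * b).
Proof.
move=> Aa vb i; rewrite mxE (le_trans (ler_norm_sum _ _ _))//.
apply: (@le_trans _ _ (\sum_(j < n) a * b)).
  by apply: ler_sum => j _; rewrite normrM ler_pM.
by rewrite sumr_const card_ord mulr_natl.
Qed.

Lemma mx_entries_bounded m n (A : 'M[R]_(m, n)) :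
  exists2 a : R, 0 <= a & forall i j, `|A i j| <= a.
Proof.
exists (\sum_i \sum_j `|A i j|).
  by apply: sumr_ge0 => i _; apply: sumr_ge0.
move=> i j; rewrite (bigD1 i)//= (bigD1 j)//= -addrA lerDl addr_ge0//.
  by apply: sumr_ge0.
by apply: sumr_ge0 => k _; apply: sumr_ge0.
Qed.

(** A bound, in terms of Sigma only, on the entries of any matrix A with
    A A^T = Sigma. *)
Definition diag_bound n (Sigma : 'M[R]_n) : R := 1 + \sum_i `|Sigma i i|.

(** The i-th diagonal entry of A A^T is the squared norm of the i-th row of A,
    and |x| <= 1 + x ^ 2. *)
Lemma factor_bound n (A : 'M[R]_n) i j : `|A i j| <= diag_bound (A *m A^T).
Proof.
have le1 (x : R) : `|x| <= 1 + x * x.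
  by rewrite -expr2 -real_normK ?num_real//; have := normr_ge0 x; nra.
apply: le_trans (le1 _) _; rewrite /diag_bound lerD2l.
have -> : A i j * A i j = `|A i j * A i j|.
  by rewrite ger0_norm// -expr2 sqr_ge0.
rewrite (bigD1 i)//= -[leLHS]addr0 lerD//; last by apply: sumr_ge0.
rewrite [in leRHS]mxE ger0_norm; last first.
  by rewrite -expr2 sqr_ge0.
rewrite ger0_norm; last first.
  by apply: sumr_ge0 => k _; rewrite mxE -expr2 sqr_ge0.
rewrite (bigD1 j)//= mxE lerDl; apply: sumr_ge0 => k _.
by rewrite mxE -expr2 sqr_ge0.
Qed.

End matrix_bounds.

Section positive_definite.
Context {R : realType}.

Lemma posdef_unitmx n (A : 'M[R]_n) : posdef A -> A \in unitmx.
Proof.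
move=> [_ A0]; rewrite -row_free_unit -kermx_eq0; apply/negPn/negP => /rowV0Pn[v].
move=> /sub_kermxP vA v0; have := A0 v^T.
rewrite trmx_eq0 trmxK vA mul0mx mxE ltxx => /(_ v0).
by [].
Qed.

Lemma posdef_invmx n (A : 'M[R]_n) : posdef A -> posdef (invmx A).
Proof.
move=> pA; have uA := posdef_unitmx pA; case: (pA) => sA A0; split.
  by rewrite trmx_inv sA.
move=> v v0; have -> : v^T *m invmx A *m v = (invmx A *m v)^T *m A *m (invmx A *m v).
  by rewrite trmx_mul trmx_inv sA -!mulmxA mulKVmx.
apply: A0; apply: contra_neq v0 => /(congr1 (mulmx A)).
by rewrite mulKVmx// mulmx0.
Qed.

Lemma posdefZ n (A : 'M[R]_n) (a : R) : 0 < a -> posdef A -> posdef (a *: A).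
Proof.
move=> a0 [sA A0]; split; first by rewrite linearZ /= sA.
by move=> v v0; rewrite -scalemxAr -scalemxAl mxE mulr_gt0// A0.
Qed.

Lemma posdefD n (A B : 'M[R]_n) : posdef A -> possemidef B -> posdef (A + B).
Proof.
move=> [sA A0] [sB B0]; split; first by rewrite linearD /= sA sB.
by move=> v v0; rewrite mulmxDr mulmxDl mxE ltr_wpDr// A0.
Qed.

Lemma posdef_congr_psd m n (B : 'M[R]_m) (H : 'M[R]_(m, n)) :
  posdef B -> possemidef (H^T *m B *m H).
Proof.
move=> [sB B0]; split; first by rewrite !trmx_mul trmxK sB mulmxA.
move=> v; have -> : v^T *m (H^T *m B *m H) *m v = (H *m v)^T *m B *m (H *m v).
  by rewrite trmx_mul !mulmxA.
have [->|Hv0] := eqVneq (H *m v) 0; first by rewrite mulmx0 mxE.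
exact/ltW/B0.
Qed.

Lemma opf_C_unitmx n p (H : 'M[R]_(p, n)) (Sigma : 'M[R]_n) (Gamma : 'M[R]_p) :
  posdef Sigma -> posdef Gamma -> opf_C H Sigma Gamma \in unitmx.
Proof.
move=> pS pG; rewrite unitmx_inv; apply: posdef_unitmx.
apply: posdefD; first exact: posdef_invmx.
exact/posdef_congr_psd/posdef_invmx.
Qed.

End positive_definite.

(** * Gaussian vectors with a general covariance *)

Section gaussian_vectors.
Context {R : realType} {n : nat}.

(** The mass that the standard normal law gives to [-1, 1]. *)
Definition normal_mass : R := fine (normal_prob (0 : R) 1 `[(-1)%R, 1%R]).

Lemma normal_mass_gt0 : 0 < normal_mass.
Proof.
apply: fine_gt0; rewrite normal_prob_itv_gt0/=.
by apply: (@le_lt_trans _ _ 1%E); [exact: probability_le1|exact: ltry].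
Qed.

Lemma normal_mass_le1 : normal_mass <= 1.
Proof.
rewrite -lee_fin fineK; first exact: probability_le1.
exact: fin_num_measure.
Qed.

(** A lower bound that depends on the dimension only, on the mass of a ball whose
    radius depends on the covariance only. *)
Lemma gaussian_bounded (Sigma : 'M[R]_n) (mu : set 'cV[R]_n -> \bar R) :
  gaussian Sigma mu ->
  ((normal_mass ^+ n)%:E <=
   mu (sup_ball (n%:R * diag_bound Sigma)%R))%E.
Proof.
move=> [A [g [AA g_std muE]]].
rewrite (muE _ (measurable_sup_ball _)) /pushforward -(std_gaussian_unit_box g_std).
apply: le_measure; rewrite ?inE.
- exact: measurable_sup_ball.
- rewrite -[X in measurable X]setTI; apply: measurable_mulmx => //.
  exact: measurable_sup_ball.
move=> z zb i /=; rewrite -AA -[diag_bound _]mulr1.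
by apply: mulmx_bound => // j k; exact: factor_bound.
Qed.

(** All translates of a nondegenerate Gaussian law by vectors of a bounded set
    dominate one and the same nonzero measure. *)
Lemma gaussian_minorization (C : 'M[R]_n) (mu : set 'cV[R]_n -> \bar R) (M : R) :
  C \in unitmx -> gaussian C mu ->
  exists nu : {measure set 'cV[R]_n -> \bar R},
    nu setT = ((shift_factor (n%:R * (diag_bound (invmx C) * M)) *
                normal_mass) ^+ n)%:E /\
    forall (c : 'cV[R]_n) E, (forall i, `|c i 0| <= M) -> measurable E ->
      (nu E <= mu [set x : 'cV[R]_n | E (c + x)%R])%E.
Proof.
move=> uC [A [g [AA g_std muE]]].
have uA : A \in unitmx.
  by move: uC; rewrite -AA unitmx_mul => /andP[].
set k := shift_factor _.
have k0 : 0 <= k ^+ n by rewrite exprn_ge0// ltW// shift_factor_gt0.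
(* the measure is the law of A Z restricted to the event that Z lies in the unit
   box, up to the factor k ^+ n *)
pose box := [set x | sup_ball 1 (invmx A *m x)].
have mbox : measurable box.
  rewrite -[X in measurable X]setTI; apply: measurable_mulmx => //.
  exact: measurable_sup_ball.
pose L : {RV g >-> 'cV[R]_n} := mfun_Sub (mem_set (measurable_mulmx A)).
pose nu := mscale (NngNum k0) (mrestr (distribution g L) mbox).
have nuE E : nu E = ((k ^+ n)%:E * g [set z | E (A *m z) /\ sup_ball 1 z])%E.
  rewrite /nu /mscale/= /mrestr/= /distribution /pushforward; congr (_ * g _)%E.
  by apply/seteqP; split => z [Ez zb]; split => //; move: zb; rewrite /box/= mulKmx.
exists nu; split.
  apply: etrans (nuE setT) _.
  rewrite exprMn EFinM -(std_gaussian_unit_box g_std); congr (_ * g _)%E.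
  by apply/seteqP; split => z //= -[].
move=> c E cM mE.
have mEc : measurable [set x : 'cV[R]_n | E (c + x)].
  by under eq_set do rewrite addrC; exact: measurable_shift_cV.
pose b := invmx A *m c.
have bB i : `|b i 0| <= n%:R * (diag_bound (invmx C) * M).
  apply: mulmx_bound => // {}i j.
  (* the transpose of invmx A is a square root factor of invmx C *)
  have -> : invmx C = (invmx A)^T *m (invmx A)^T^T.
    rewrite trmxK -[RHS]mul1mx -(mulVmx uC) -mulmxA -AA -mulmxA.
    rewrite [A^T *m _]mulmxA -trmx_mul mulVmx// trmx1 mul1mx mulmxV// mulmx1.
    by rewrite AA.
  by have := factor_bound (invmx A)^T j i; rewrite mxE.
have mEA : measurable [set z | E (A *m z)].
  by rewrite -[X in measurable X]setTI; exact: measurable_mulmx.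
rewrite [leLHS](nuE E) muE// /pushforward.
apply: le_trans (std_gaussian_shift g_std bB mEA) _.
rewrite le_eqVlt; apply/orP; left; apply/eqP; congr (g _).
by apply/seteqP; split => z /=; rewrite mulmxDr /b mulKVmx// addrC.
Qed.

End gaussian_vectors.

(** * Minorization for the particle filter *)

Section opf_bounds.
Context {R : realType} {n p N : nat}.
Context (psi : 'cV[R]_n -> 'cV[R]_n) (H : 'M[R]_(p, n)) (Sigma : 'M[R]_n)
  (Gamma : 'M[R]_p).
Local Notation rawweight := (opf_rawweight psi H Sigma Gamma).
Local Notation weight := (opf_weight psi H Sigma Gamma).
Local Notation alpha := (opf_alpha psi H Sigma Gamma).
Local Notation proposal := (opf_proposal psi H Sigma Gamma).
Local Notation ostep := (opf_step psi H Sigma Gamma).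

Lemma opf_weight_ge0 y (u : N.-tuple 'cV[R]_n) m : 0 <= weight y u m.
Proof.
apply: divr_ge0; first exact/ltW/opf_rawweight_gt0.
apply: sumr_ge0 => l _; exact/ltW/opf_rawweight_gt0.
Qed.

(** If all the uniform variables fall into the interval of the particle
    numbered 0, every particle is resampled from its proposal. *)
Lemma opf_step_first y u zeta rho (i0 : 'I_N) : val i0 = 0%N ->
  (forall i, 0 <= rho i < weight y u i0) ->
  ostep y u zeta rho = [tuple proposal y u zeta i0 | i < N].
Proof.
move=> i00 rho_lt.
have alpha0 : alpha y u 0 = 0 by rewrite /opf_alpha big_pred0.
have alpha1 : alpha y u 1 = weight y u i0.
  rewrite /opf_alpha (bigD1 i0) ?i00//= big1 ?addr0// => l /andP[].
  rewrite ltnS leqn0 => /eqP l0; rewrite (_ : l = i0) ?eqxx//.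
  by apply: val_inj; rewrite i00.
have alpha_ge m : (0 < m)%N -> weight y u i0 <= alpha y u m.
  move=> m0; rewrite /opf_alpha (bigD1 i0) ?i00//= lerDl.
  by apply: sumr_ge0 => l _; exact: opf_weight_ge0.
apply: eq_from_tnth => i; rewrite !tnth_mktuple (bigD1 i0)//= big1 ?addr0.
  rewrite indicE mem_set ?scale1r// /opf_interval /= in_itv/= i00 alpha0 alpha1.
  exact: rho_lt.
move=> m mi0; rewrite indicE memNset ?scale0r// /opf_interval /= in_itv/=.
have m0 : (0 < m)%N.
  by rewrite lt0n; apply: contra mi0 => /eqP m0; apply/eqP/val_inj; rewrite i00.
case/andP => am _; have /andP[_] := rho_lt i; rewrite ltNge; case/negP.
exact: le_trans (alpha_ge m m0) am.
Qed.

Hypothesis psi_bounded : [bounded psi x | x in [set: 'cV[R]_n]].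

Lemma psi_coord_bounded :
  exists2 b : R, 0 <= b & forall x i, `|psi x i 0| <= b.
Proof.
have [M [_ /(_ (Num.max M 0 + 1))]] := psi_bounded.
have M0 : 0 <= Num.max M 0 by rewrite le_max lexx orbT.
have MM : M < Num.max M 0 + 1.
  by apply: (@le_lt_trans _ _ (Num.max M 0)); rewrite ?le_max ?lexx// ltrDl.
move=> /(_ MM) psiM.
exists (Num.max M 0 + 1); first by rewrite addr_ge0.
move=> x i; apply: le_trans (psiM x I); rewrite /Num.norm/= mx_normrE.
exact: (le_bigmax _ (fun ij => `|psi x ij.1 ij.2|) (i, 0)).
Qed.

Lemma sqnorm_wrt_bounded k (S : 'M[R]_k) (b : R) : exists2 L : R, 0 <= L &
  forall v : 'cV[R]_k, (forall i, `|v i 0| <= b) -> `|sqnorm_wrt S v| <= L.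
Proof.
have [a a0 Sa] := mx_entries_bounded (invmx S).
pose b' := Num.max b 0.
have b'0 : 0 <= b' by rewrite le_max lexx orbT.
exists (k%:R * (b' * (k%:R * (a * b')))); first by rewrite !mulr_ge0.
move=> v vb; rewrite /sqnorm_wrt -mulmxA.
have vb' i : `|v i 0| <= b' by rewrite le_max vb.
apply: mulmx_bound => [i j|j]; first by rewrite mxE (ord1 i); exact: vb'.
exact: mulmx_bound.
Qed.

(** Observations in a bounded set keep the weights away from 0. *)
Lemma opf_weight_bounded_below (M : R) : (0 < N)%N -> exists2 w : R, 0 < w < 1 &
  forall (y : 'cV[R]_p) (u : N.-tuple 'cV[R]_n) m,
    (forall i, `|y i 0| <= M) -> w <= weight y u m.
Proof.
move=> N0.
have [b b0 psib] := psi_coord_bounded.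
have [a a0 Ha] := mx_entries_bounded H.
have [L L0 SL] := sqnorm_wrt_bounded (opf_S H Sigma Gamma) (M + n%:R * (a * b)).
pose e := expR (- (2^-1 * L)); pose f := expR (2^-1 * L).
have e0 : 0 < e by exact: expR_gt0.
have f0 : 0 < f by exact: expR_gt0.
have NR : 0 < N%:R :> R by rewrite ltr0n.
(* e and f bound the unnormalized weights from below and from above *)
have raw (y : 'cV[R]_p) (u : N.-tuple 'cV[R]_n) m : (forall i, `|y i 0| <= M) ->
    e <= rawweight y u m <= f.
  move=> yM; rewrite /opf_rawweight !ler_expR.
  have : `|sqnorm_wrt (opf_S H Sigma Gamma) (y - H *m psi (tnth u m))| <= L.
    apply: SL => i; rewrite !mxE; apply: le_trans (ler_normB _ _) _.
    apply: lerD => //; have := mulmx_bound Ha (psib (tnth u m)) i.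
    by rewrite mxE.
  by rewrite ler_norml => /andP[s1 s2]; apply/andP; split; lra.
(* the minimum with 1 / 2 only ensures that the bound is smaller than 1 *)
exists (Num.min (e / (N%:R * f)) 2^-1).
  apply/andP; split; first by rewrite lt_min divr_gt0 ?mulr_gt0//=; lra.
  by rewrite gt_min; apply/orP; right; lra.
move=> y u m yM; rewrite ge_min; apply/orP; left.
have sum0 : 0 < \sum_(l < N) rawweight y u l.
  rewrite (bigD1 m)//= ltr_wpDr ?opf_rawweight_gt0// sumr_ge0// => l _.
  exact/ltW/opf_rawweight_gt0.
rewrite /opf_weight; apply: ler_pM => //.
- exact: ltW.
- by rewrite invr_ge0 ltW// mulr_gt0.
- by have /andP[] := raw y u m yM.
rewrite lef_pV2 ?posrE ?mulr_gt0//.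
apply: (@le_trans _ _ (\sum_(l < N) f)).
  by apply: ler_sum => l _; have /andP[] := raw y u l yM.
by rewrite sumr_const card_ord mulr_natl.
Qed.

(** The means of the proposals are bounded uniformly in the particle. *)
Lemma opf_mean_bounded (M : R) : exists B : R,
  forall x (y : 'cV[R]_p) i, (forall j, `|y j 0| <= M) ->
  `|((1%:M - opf_K H Sigma Gamma *m H) *m psi x + opf_K H Sigma Gamma *m y) i 0| <= B.
Proof.
have [b b0 psib] := psi_coord_bounded.
have [a a0 Aa] := mx_entries_bounded (1%:M - opf_K H Sigma Gamma *m H).
have [k k0 Kk] := mx_entries_bounded (opf_K H Sigma Gamma).
exists (n%:R * (a * b) + p%:R * (k * M)) => x y i yM; rewrite mxE.
by apply: le_trans (ler_normD _ _) _; apply: lerD; exact: mulmx_bound.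
Qed.

End opf_bounds.

(** The image of a measure as a bundled measure. *)
Lemma pushforward_measure {R : realType} {d d' : measure_display}
    {T : measurableType d} {T' : measurableType d'}
    (m : {measure set T -> \bar R}) (f : T -> T') : measurable_fun setT f ->
  exists nu : {measure set T' -> \bar R}, forall E, nu E = m (f @^-1` E).
Proof.
move=> mf.
by eexists (Measure.clone _ _ _ (pushforward m f) _) => E.
Unshelve. exact: mf.
Qed.

Lemma uniform_prob_itv {R : realType} (w : R) : 0 < w < 1 ->
  uniform_prob (@ltr01 R) `[0, w[%classic = w%:E.
Proof.
move=> /andP[w0 w1]; rewrite /uniform_prob integral_uniform_pdf.
rewrite setIidl; last first.
  by move=> x /=; rewrite !in_itv/= => /andP[-> /ltW /le_trans]; apply; exact: ltW.
rewrite (eq_integral (fun=> 1%E)).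
  by rewrite integral_cst//= mul1e lebesgue_measure_itv/= lte_fin w0 -EFinD subr0.
move=> x; rewrite inE/= in_itv/= => /andP[x0 xw].
by rewrite /uniform_pdf x0 (le_trans (ltW xw) (ltW w1)) subr0 invr1.
Qed.

Section filter_chain.
Context {R : realType} {n p N : nat}.
Context (psi : 'cV[R]_n -> 'cV[R]_n) (H : 'M[R]_(p, n)) (Sigma : 'M[R]_n)
  (Gamma : 'M[R]_p).
Hypothesis N_gt0 : (0 < N)%N.
Hypothesis psi_measurable : measurable_fun [set: 'cV[R]_n] psi.
Hypothesis psi_bounded : [bounded psi x | x in [set: 'cV[R]_n]].
Hypothesis Sigma_posdef : posdef Sigma.
Hypothesis Gamma_posdef : posdef Gamma.
Context {d : measure_display} {T : measurableType d} (P : probability T R)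
    (xi : nat -> {RV P >-> 'cV[R]_n}) (eta : nat -> {RV P >-> 'cV[R]_p})
    (zeta : nat -> 'I_N -> {RV P >-> 'cV[R]_n})
    (rho : nat -> 'I_N -> {RV P >-> R}).
Hypothesis zeta_gaussian :
  forall k i, gaussian (opf_C H Sigma Gamma) (distribution P (zeta k i)).
Hypothesis rho_uniform : forall k i, uniform01 (distribution P (rho k i)).
Hypothesis noises_indep : mutually_independent P (noise_sigma xi eta zeta rho).
Local Notation F := (noise_sigma xi eta zeta rho).
Local Notation ensemble := (N.-tuple 'cV[R]_n).
Local Notation index := ((nat + nat) + (nat * 'I_N + nat * 'I_N))%type.

(** With probability bounded below, whatever the present ensemble, all the new
    particles coincide with a single Gaussian proposal, whose law dominates a
    measure that does not depend on the ensemble. *)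
Lemma opf_minorization (M : R) : exists2 e : R, 0 < e < 1 &
  forall (y : 'cV[R]_p) k, (forall i, `|y i 0| <= M) ->
  exists nu : {measure set ensemble -> \bar R}, nu setT = e%:E /\
    forall u E, measurable E ->
      (nu E <= P [set t | E (opf_step psi H Sigma Gamma y u
                               (fun i => zeta k i t) (fun i => rho k i t))])%E.
Proof.
have [w w01 weight_ge] :=
  opf_weight_bounded_below H Sigma Gamma psi_bounded M N_gt0.
have [B meanB] := opf_mean_bounded H Sigma Gamma psi_bounded M.
have uC := opf_C_unitmx H Sigma_posdef Gamma_posdef.
have /andP[w0 w1] := w01.
pose c := shift_factor (n%:R * (diag_bound (invmx (opf_C H Sigma Gamma)) * B)) *
  @normal_mass R.
have c0 : 0 < c by rewrite mulr_gt0 ?shift_factor_gt0// normal_mass_gt0.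
have c1 : c <= 1.
  apply: mulr_ile1; [exact/ltW/shift_factor_gt0|exact/ltW/normal_mass_gt0| |].
    exact: shift_factor_le1.
  exact: normal_mass_le1.
have cn1 : c ^+ n <= 1 by apply: exprn_ile1 => //; exact: ltW.
have wN1 : w ^+ N < 1 by rewrite exprn_ilt1 ?ltW// -lt0n.
(* w ^+ N for the uniform variables, c ^+ n for the Gaussian vector *)
exists (w ^+ N * c ^+ n).
  rewrite mulr_gt0 ?exprn_gt0//= (le_lt_trans _ wN1)//.
  by apply: ler_piMr => //; rewrite exprn_ge0// ltW.
move=> y k yM; pose i0 : 'I_N := Ordinal N_gt0.
have [nu0 [nu0T nu0P]] := gaussian_minorization B uC (zeta_gaussian k i0).
pose dup (x : 'cV[R]_n) : ensemble := [tuple x | i < N].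
have mdup : measurable_fun setT dup.
  apply/measurable_fun_tnthP => i; rewrite /comp/=.
  by under eq_fun do rewrite tnth_mktuple; exact: measurable_id.
have [nu1 nu1E] := pushforward_measure nu0 mdup.
have wN0 : 0 <= w ^+ N by rewrite exprn_ge0 ?ltW.
have nuE E : mscale (NngNum wN0) nu1 E = ((w ^+ N)%:E * nu0 (dup @^-1` E))%E.
  by rewrite /mscale/= nu1E.
exists (mscale (NngNum wN0) nu1); split.
  by rewrite [LHS]nuE preimage_setT nu0T EFinM.
move=> u E mE; rewrite [leLHS]nuE.
pose m := (1%:M - opf_K H Sigma Gamma *m H) *m psi (tnth u i0) +
          opf_K H Sigma Gamma *m y.
have mdE : measurable (dup @^-1` E).
  by rewrite -[X in measurable X]setTI; exact: mdup.
pose Ed := [set x : 'cV[R]_n | E (dup (m + x))].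
have mEd : measurable Ed.
  by rewrite /Ed; under eq_set do rewrite addrC; exact: (measurable_shift_cV m mdE).
(* the event: the noise of proposal 0 lands in the target and all the uniform
   variables fall into [0, w[ *)
pose s : seq index := inr (inl (k, i0)) :: [seq inr (inr (k, i)) | i <- enum 'I_N].
pose A (i : index) : set T := match i with
  | inr (inl (j, l)) => zeta j l @^-1` Ed
  | inr (inr (j, l)) => rho j l @^-1` `[0, w[%classic
  | _ => setT end.
have us : uniq s.
  rewrite /= map_inj_uniq ?enum_uniq ?andbT; last by move=> i j [].
  by apply/mapP => -[].
have FA i : i \in s -> F i (A i).
  rewrite inE => /predU1P[->|/mapP[l _ ->]] /=.
    by exists Ed => //; rewrite setTI.
  by exists `[0, w[%classic => //; rewrite setTI.
have PA : P (\bigcap_(i in [set` s]) A i) =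
    ((w ^+ N)%:E * P (zeta k i0 @^-1` Ed))%E.
  rewrite (mutually_independent_seq noises_indep us FA) big_cons big_map muleC.
  congr (_ * _)%E; rewrite -[in RHS](card_ord N) -prodr_const -prodEFin big_enum/=.
  apply: eq_bigr => i _.
  rewrite -(uniform_prob_itv w01); apply: (rho_uniform k i).
  exact: measurable_itv.
have nu0_le := nu0P m _ (fun i => meanB (tnth u i0) y i yM) mdE.
apply: le_trans (lee_wpmul2l _ nu0_le) _; first by rewrite lee_fin.
rewrite -[leLHS]PA; apply: le_measure; rewrite ?inE.
- apply: fin_bigcap_measurable => // i /= /FA.
  exact: noise_sigma_measurable.
- rewrite -[X in measurable X]setTI.
  apply: (@measurable_opf_step _ _ _ _ _ _ _ _ psi_measurable _ _ y (fun=> u)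
    (fun t i => zeta k i t) (fun t i => rho k i t)) => //.
move=> t At /=; rewrite (@opf_step_first _ _ _ _ _ _ _ _ y u _ _ i0)//.
  have := At (inr (inl (k, i0))); rewrite /= inE eqxx => /(_ isT).
  by congr E; apply: eq_from_tnth => i; rewrite !tnth_mktuple.
move=> i; have := At (inr (inr (k, i))).
rewrite /= inE map_f ?mem_enum ?orbT// => /(_ isT); rewrite /= in_itv/=.
move=> /andP[-> rw] /=; exact: lt_le_trans rw (weight_ge _ _ _ yM).
Qed.

Section fixed_data.
Context (y : nat -> 'cV[R]_p).
Local Notation noise := (ensemble * N.-tuple R)%type.

(** One step of the filter as a function of the ensemble and of the current
    noises, collected in a pair of tuples. *)
Definition filter_step (k : nat) (x : (ensemble * noise)%type) : ensemble :=
  opf_step psi H Sigma Gamma (y k) x.1 (tnth x.2.1) (tnth x.2.2).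

(** The noises driving the step from time k to time k + 1. *)
Definition filter_noise (k : nat) (t : T) : noise :=
  ([tuple zeta k i t | i < N], [tuple rho k i t | i < N]).

Local Notation particles z k :=
  (fun t => opf psi H Sigma Gamma y z (fun j i => zeta j i t)
              (fun j i => rho j i t) k).

Lemma filter_stepE k u t : filter_step k (u, filter_noise k t) =
  opf_step psi H Sigma Gamma (y k) u (fun i => zeta k i t) (fun i => rho k i t).
Proof.
by rewrite /filter_step /filter_noise /=; congr opf_step;
  apply/funext => i; rewrite tnth_mktuple.
Qed.

Lemma chain_opf z k : chain filter_step filter_noise z k = particles z k.
Proof. by apply/funext => t; elim: k => //= k ->; exact: filter_stepE. Qed.

Lemma measurable_filter_step k : measurable_fun setT (filter_step k).
Proof.
apply: (@measurable_opf_step _ _ _ _ _ _ _ _ psi_measurable _ _ (y k) fst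
  (fun x : (ensemble * noise)%type => tnth x.2.1) (fun x => tnth x.2.2)) => //= i.
- apply: (measurableT_comp (measurable_tnth i)).
  exact: (measurableT_comp measurable_fst measurable_snd).
- apply: (measurableT_comp (measurable_tnth i)).
  exact: (measurableT_comp measurable_snd measurable_snd).
Qed.

Lemma measurable_filter_noise d' (T' : measurableType d') (X : T' -> T) k :
  (forall i, measurable_fun setT (zeta k i \o X)) ->
  (forall i, measurable_fun setT (rho k i \o X)) ->
  measurable_fun setT (filter_noise k \o X).
Proof.
move=> mz mr; apply: measurable_fun_pair; apply/measurable_fun_tnthP => i;
  rewrite /comp/=; under eq_fun do rewrite tnth_mktuple.
  exact: mz.
exact: mr.
Qed.

(* the indices of the filter noises of the steps in D *)
Let stage (D : set nat) : set index :=
  [set i | match i with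
           | inr (inl (j, _)) => D j
           | inr (inr (j, _)) => D j
           | _ => False end].

Let stage_gen D := \bigcup_(i in stage D) F i.

Let measurable_zeta_stage (D : set nat) j i : D j ->
  measurable_fun (setT : set (g_sigma_algebraType (stage_gen D))) (zeta j i).
Proof.
move=> Dj _ Y mY; apply: sub_sigma_algebra.
by exists (inr (inl (j, i))) => //; exists Y.
Qed.

Let measurable_rho_stage (D : set nat) j i : D j ->
  measurable_fun (setT : set (g_sigma_algebraType (stage_gen D))) (rho j i).
Proof.
move=> Dj _ Y mY; apply: sub_sigma_algebra.
by exists (inr (inr (j, i))) => //; exists Y.
Qed.

(** The ensemble at time k is independent of the noises driving the step from
    time k to time k + 1. *)
Lemma opf_indep z k A B : measurable A -> measurable B ->
  P (chain filter_step filter_noise z k @^-1` A `&` filter_noise k @^-1` B) =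
  (P (chain filter_step filter_noise z k @^-1` A) * P (filter_noise k @^-1` B))%E.
Proof.
move=> mA mB.
apply: (independent_blocks (@noise_sigma_sigma _ _ _ _ _ _ _ xi eta zeta rho)
  (@noise_sigma_measurable _ _ _ _ _ _ _ xi eta zeta rho) noises_indep
  (D1 := stage [set j | (j < k)%N]) (D2 := stage [set k])).
- apply/seteqP; split => // -[[j|j]|[[j i]|[j i]]] /= [//];
  by rewrite /stage/= => jk jE; rewrite jE ltnn in jk.
- rewrite chain_opf.
  have := @measurable_opf _ _ _ _ psi H Sigma Gamma psi_measurable _
    (g_sigma_algebraType (stage_gen [set j | (j < k)%N])) y z
    (fun j i => zeta j i) (fun j i => rho j i) k.
  move=> /(_ _ _ measurableT A mA); rewrite setTI; apply.
  + by move=> j i jk; exact: measurable_zeta_stage.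
  + by move=> j i jk; exact: measurable_rho_stage.
- have := @measurable_filter_noise _
    (g_sigma_algebraType (stage_gen [set k])) id k.
  move=> /(_ _ _ measurableT B mB); rewrite setTI; apply.
  + by move=> i; exact: measurable_zeta_stage.
  + by move=> i; exact: measurable_rho_stage.
Qed.

End fixed_data.

(** Each observation in the ball of radius M, for the maximum norm, contracts the
    total variation distance by a factor 1 - e. *)
Lemma opf_dTV_le (M : R) : exists2 e : R, 0 < e < 1 &
  forall (y : nat -> 'cV[R]_p) (z z' : ensemble) k,
  (dTV (opf_law psi H Sigma Gamma P zeta rho y z k)
       (opf_law psi H Sigma Gamma P zeta rho y z' k) <=
   (\prod_(j < k) (1 - (if [forall i, `|y j i 0| <= M] then e else 0)))%:E)%E.
Proof.
have [e e01 minor] := opf_minorization M; exists e => // y z z' k.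
have /andP[e0 e1] := e01.
pose ek j := if [forall i, `|y j i 0| <= M] then e else 0.
have /choice[nu nuP] : forall j, exists nu : {measure set ensemble -> \bar R},
    nu setT = (ek j)%:E /\ forall u E, measurable E ->
    (nu E <= P [set t | E (filter_step y j (u, filter_noise j t))])%E.
  move=> j; rewrite /ek; case: ifPn => [/forallP yM|_].
    have [nu [nuT nuE]] := minor (y j) j yM; exists nu; split => // u E mE.
    by under eq_set do rewrite filter_stepE; exact: nuE.
  exists (mzero : {measure set ensemble -> \bar R}); split => // u E mE.
  exact: measure_ge0.
have mn j : measurable_fun setT (filter_noise j).
  by apply: (@measurable_filter_noise _ T id).
have mc x : measurable_fun setT (chain (filter_step y) filter_noise x k).
  exact: (measurable_chain (@measurable_filter_step y) mn).
have ek1 j : ek j < 1 by rewrite /ek; case: ifP.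
rewrite /opf_law -!chain_opf; apply: dTV_pushforward_le => // h mh h01.
have nuT j : nu j setT = (ek j)%:E by case: (nuP j).
have nuE j := (nuP j).2.
by split; apply: (expectation_contraction (@measurable_filter_step y) mn
  (opf_indep y) nuT ek1 nuE).
Qed.

End filter_chain.

(** * Almost sure frequency of contracting steps *)

Section independent_discounts.
Context {R : realType} {d : measure_display} {T : measurableType d}.
Context (P : probability T R) (A : nat -> set T) (e q : R).
Hypothesis mA : forall j, measurable (A j).
Hypothesis A_indep : forall s : seq nat, uniq s ->
  P (\bigcap_(j in [set` s]) A j) = (\prod_(j <- s) P (A j))%E.
Hypothesis PA_ge : forall j, (q%:E <= P (A j))%E.
Hypothesis e_gt0 : 0 < e.
Hypothesis e_lt1 : e < 1.

(** The product of the discounts 1 - e over the events that occur before k. *)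
Definition discount (k : nat) (t : T) : R :=
  \prod_(j < k) (1 - e * \1_(A j) t).

Let factor_ge0 j t : 0 <= 1 - e * \1_(A j) t.
Proof. by rewrite indicE; case: (t \in A j) => /=; move: e_lt1; rewrite ?mulr1 ?mulr0; lra. Qed.

Lemma discount_ge0 k t : 0 <= discount k t.
Proof. by apply: prodr_ge0. Qed.

Lemma measurable_discount k : measurable_fun setT (discount k).
Proof.
rewrite /discount; elim: k => [|k IHk].
  by under eq_fun do rewrite big_ord0; exact: measurable_cst.
under eq_fun do rewrite big_ord_recr/=.
apply: measurable_funM => //; apply: measurable_funB => //.
by apply: measurable_funM => //; exact: measurable_indic.
Qed.

Let pr j := fine (P (A j)).

Let prE j : P (A j) = (pr j)%:E.
Proof. by rewrite /pr fineK// fin_num_measure. Qed.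

Let mI (s : seq nat) : measurable (\bigcap_(j in [set` s]) A j).
Proof. by apply: fin_bigcap_measurable. Qed.

(* The induction needs the expectation of the discount on the intersection of
   later events. *)
Let expectation_discount_cond k (s : seq nat) : uniq s ->
  (forall j, j \in s -> (k <= j)%N) ->
  (\int[P]_t (discount k t * \1_(\bigcap_(j in [set` s]) A j) t)%:E =
   ((\prod_(j < k) (1 - e * pr j)) * \prod_(j <- s) pr j)%:E)%E.
Proof.
elim: k s => [|k IHk] s us sk.
  under eq_integral do rewrite /discount big_ord0 mul1r.
  rewrite integral_indic// setIT big_ord0 mul1r.
  rewrite [LHS](A_indep us) -prodEFin.
  by apply: eq_bigr => j _; rewrite prE.
have ks : k \notin s by apply/negP => /sk; rewrite ltnn.
have usk : uniq (k :: s) by rewrite /= ks.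
have [I0 I1] : (\int[P]_t (discount k t * \1_(\bigcap_(j in [set` s]) A j) t)%:E =
    ((\prod_(j < k) (1 - e * pr j)) * \prod_(j <- s) pr j)%:E)%E /\
  (\int[P]_t (discount k t * \1_(\bigcap_(j in [set` k :: s]) A j) t)%:E =
    ((\prod_(j < k) (1 - e * pr j)) * \prod_(j <- k :: s) pr j)%:E)%E.
  split; apply: IHk => //; first by move=> j /sk /ltnW.
  by move=> j; rewrite inE => /predU1P[->//|/sk /ltnW].
have mdi l (s' : seq nat) : measurable_fun setT (fun t =>
    (discount l t * \1_(\bigcap_(j in [set` s']) A j) t)%:E).
  apply/measurable_EFinP; apply: measurable_funM; first exact: measurable_discount.
  exact: measurable_indic.
have di0 l (s' : seq nat) t : setT t ->
    (0 <= (discount l t * \1_(\bigcap_(j in [set` s']) A j) t)%:E)%E.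
  by move=> _; rewrite lee_fin mulr_ge0// discount_ge0.
(* expanding the last factor of the discount *)
have splitE t : ((discount k t * \1_(\bigcap_(j in [set` s]) A j) t)%:E =
  (discount k.+1 t * \1_(\bigcap_(j in [set` s]) A j) t)%:E +
  e%:E * (discount k t * \1_(\bigcap_(j in [set` k :: s]) A j) t)%:E)%E.
  have -> : [set` k :: s] = k |` [set` s].
    by apply/seteqP; split => j /=; rewrite inE => /predU1P.
  rewrite bigcap_setU1 indicI /= -EFinM -EFinD; congr (_%:E).
  by rewrite {2}/discount big_ord_recr/= -/(discount k t); ring.
have := I0; under eq_integral do rewrite splitE.
have di0S : forall t, setT t -> _ := @di0 k.+1 s.
rewrite ge0_integralD//; last 2 first.
- by move=> t _; apply: mule_ge0; [rewrite lee_fin ltW|exact: di0].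
- by apply: emeasurable_funM => //; exact: measurable_cst.
rewrite ge0_integralZl_EFin//; [|by move=> t; exact: di0|exact: ltW].
rewrite I1 big_cons big_ord_recr/=.
case: (\int[P]_t _)%E => [r| |] //; rewrite -EFinM -EFinD => -[rE]; congr (_%:E).
by move: rE; set p1 := \prod_(_ < k) _; set p2 := \prod_(_ <- s) _; nra.
Qed.

Let pr_ge j : q <= pr j.
Proof. by rewrite -lee_fin -prE. Qed.

Lemma event_bound_le1 : q <= 1.
Proof. by rewrite -lee_fin (le_trans (PA_ge 0%N))// probability_le1. Qed.

Lemma expectation_discount k : (\int[P]_t (discount k t)%:E <= ((1 - e * q) ^+ k)%:E)%E.
Proof.
have := @expectation_discount_cond k [::] isT (fun j => ltac:(by [])).
rewrite big_nil mulr1 => I0.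
rewrite (_ : (\int[P]_t _)%E = ((\prod_(j < k) (1 - e * pr j)))%:E); last first.
  rewrite -I0; apply: eq_integral => t _; rewrite indicE mem_set ?mulr1//.
rewrite lee_fin -[k in leRHS]card_ord -prodr_const; apply: ler_prod => j _.
have p1 : pr j <= 1 by rewrite -lee_fin -prE probability_le1.
have epq : e * q <= e * pr j by rewrite ler_pM2l// pr_ge.
have ep1 : e * pr j <= e by rewrite ler_piMr// ltW.
by move: e_lt1 => e1; apply/andP; split; lra.
Qed.

(** Almost surely the discount decays geometrically. *)
Lemma discount_ae_le (b : R) : 1 - e * q < b ->
  {ae P, forall t, exists K, forall k, (K <= k)%N -> discount k t <= b ^+ k}.
Proof.
move=> ab; have a0 : 0 < 1 - e * q.
  have : e * q <= e by rewrite ler_piMr ?event_bound_le1// ltW.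
  by move: e_lt1; lra.
have b0 : 0 < b by exact: lt_trans ab.
pose E k := [set t | b ^+ k < discount k t].
have mE k : measurable (E k).
  rewrite /E -[X in measurable X]setTI.
  rewrite (_ : [set t | _] = discount k @^-1` `]b ^+ k, +oo[).
    exact: measurable_discount.
  by apply/seteqP; split => t /=; rewrite in_itv/= andbT.
pose r := (1 - e * q) / b.
have r0 : 0 < r by rewrite divr_gt0.
have r1 : r < 1 by rewrite ltr_pdivrMr// mul1r.
(* Markov's inequality *)
have PE k : (P (E k) <= (r ^+ k)%:E)%E.
  have bk : 0 < b ^+ k by rewrite exprn_gt0.
  have : ((b ^+ k)%:E * P (E k) <= ((1 - e * q) ^+ k)%:E)%E.
    apply: le_trans (expectation_discount k).
    have PEint : P (E k) = (\int[P]_t (\1_(E k) t)%:E)%E.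
      by rewrite integral_indic// setIT.
    have mind : measurable_fun setT (fun t => (\1_(E k) t)%:E : \bar R).
      by apply/measurable_EFinP; exact: measurable_indic.
    have ind0 t : setT t -> (0 <= (\1_(E k) t)%:E :> \bar R)%E by rewrite lee_fin.
    rewrite PEint -(ge0_integralZl_EFin P measurableT ind0 mind (ltW bk)).
    apply: ge0_le_integral => //.
    - by move=> t _; apply: mule_ge0; rewrite lee_fin// ltW.
    - by apply: emeasurable_funM; [exact: measurable_cst|exact: mind].
    - by apply/measurable_EFinP; exact: measurable_discount.
    move=> t _; rewrite -EFinM lee_fin indicE.
    case: (boolP (t \in E k)); rewrite ?mulr1 ?mulr0 ?discount_ge0//.
    by rewrite in_setE => /ltW.
  have PEfin : P (E k) = (fine (P (E k)))%:E by rewrite fineK// fin_num_measure.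
  by rewrite PEfin -EFinM !lee_fin /r expr_div_n ler_pdivlMr// mulrC.
have sumE : (\sum_(k <oo) P (E k) < +oo)%E.
  apply: (@le_lt_trans _ _ (1 / (1 - r))%:E); last exact: ltry.
  apply: lime_le; first by apply: is_cvg_nneseries => k _ _.
  apply: nearW => k; rewrite big_mkord.
  apply: (@le_trans _ _ (series (geometric 1 r) k)%:E).
    rewrite /series/= big_mkord -sumEFin; apply: lee_sum => i _.
    by rewrite /geometric/= mul1r; exact: PE.
  by rewrite lee_fin geometric_le_lim// ger0_norm// ltW.
exists (lim_sup_set E); split.
- by apply: bigcap_measurable => // k _; apply: bigcup_measurable => j _.
- exact: lim_sup_set_cvg0.
move=> t /=; apply: contra_notP => tE.
have : exists K, forall k, (K <= k)%N -> ~ E k t.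
  apply: contra_notP tE => /forallNP tE K _.
  by have /existsNP[k /not_implyP[Kk /contrapT Ek]] := tE K; exists k.
by move=> [K KE]; exists K => k /KE /negP; rewrite -leNgt.
Qed.

End independent_discounts.

Lemma dTV_ge0 {R : realType} d (T : measurableType d) (mu nu : set T -> \bar R) :
  (0 <= dTV mu nu)%E.
Proof.
apply: mule_ge0; first by rewrite lee_fin invr_ge0.
apply: le_trans (abse_ge0 _) (ereal_sup_ubound _).
by exists (cst 0) => //; split => [|x]; [exact: measurable_cst|rewrite normr0].
Qed.

(** Geometric decay bounds the limit superior of the k-th roots. The term of
    index 0, a power with exponent 0, is discarded. *)
Lemma limn_esup_root_le {R : realType} (u : nat -> \bar R) (b : R) (K : nat) :
  0 < b -> (forall k, 0 <= u k)%E -> (forall k, (K <= k)%N -> (u k <= (b ^+ k)%:E)%E) ->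
  (limn_esup (fun k => poweR (u k) (k%:R^-1)) <= b%:E)%E.
Proof.
move=> b0 u0 ub.
(* the supremum of the terms of index k > K bounds the limit superior *)
apply: le_trans (ereal_inf_lbound _) (_ : _ <= _)%E.
  exists [set k | (K < k)%N] => //; exact: nbhs_infty_gt.
apply: ge_ereal_sup => _ [k /= Kk <-].
have k0 : (0 < k)%N by exact: leq_ltn_trans Kk.
have -> : b%:E = (poweR (b ^+ k)%:E k%:R^-1).
  rewrite poweR_EFin -powR_mulrn ?ltW// -powRrM mulfV ?pnatr_eq0 ?gt_eqF//.
  by rewrite powRr1// ltW.
apply: gt0_ler_poweR; rewrite ?invr_ge0// ?in_itv/= ?leey ?andbT//.
  by rewrite lee_fin exprn_ge0// ltW.
exact/ub/ltnW.
Qed.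

(** * Boundedness of the observations *)

Section observations.
Context {R : realType} {n p : nat} (psi : 'cV[R]_n -> 'cV[R]_n)
  (H : 'M[R]_(p, n)) (sigma gamma : R) (u0 : 'cV[R]_n).
Hypothesis psi_bounded : [bounded psi x | x in [set: 'cV[R]_n]].

(** Since psi is bounded, each observation is controlled by the two noises of
    its own time step. *)
Lemma observation_bounded (r r' : R) : exists M : R,
  forall (xi : nat -> 'cV[R]_n) (eta : nat -> 'cV[R]_p) k,
    sup_ball r (xi k) -> sup_ball r' (eta k) ->
    sup_ball M (observation psi H sigma gamma u0 xi eta k).
Proof.
have [b b0 psib] := psi_coord_bounded psi_bounded.
have [a a0 Ha] := mx_entries_bounded H.
exists (n%:R * (a * (b + `|sigma / gamma * gamma| * r)) + `|gamma| * r').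
move=> xi eta k xir etar i; rewrite mxE.
apply: le_trans (ler_normD _ _) _; apply: lerD.
  apply: mulmx_bound => // j; rewrite /= mxE.
  apply: le_trans (ler_normD _ _) _; apply: lerD => //.
  by rewrite mxE normrM ler_wpM2l.
by rewrite mxE normrM ler_wpM2l.
Qed.

End observations.

Section data_events.
Context {R : realType} {n p N : nat} {d : measure_display} {T : measurableType d}
  (P : probability T R).
Context (xi : nat -> {RV P >-> 'cV[R]_n}) (eta : nat -> {RV P >-> 'cV[R]_p})
  (zeta : nat -> 'I_N -> {RV P >-> 'cV[R]_n})
  (rho : nat -> 'I_N -> {RV P >-> R}).
Hypothesis noises_indep : mutually_independent P (noise_sigma xi eta zeta rho).
Local Notation index := ((nat + nat) + (nat * 'I_N + nat * 'I_N))%type.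

(** The events that both noises of the j-th step of the data lie in given sets
    are independent for distinct j. *)
Lemma data_events_indep (X : set 'cV[R]_n) (Y : set 'cV[R]_p) (s : seq nat) :
  measurable X -> measurable Y -> uniq s ->
  P (\bigcap_(j in [set` s]) (xi j @^-1` X `&` eta j @^-1` Y)) =
  (\prod_(j <- s) (P (xi j @^-1` X) * P (eta j @^-1` Y)))%E.
Proof.
move=> mX mY us.
pose s2 : seq index := [seq inl (inl j) | j <- s] ++ [seq inl (inr j) | j <- s].
pose E (i : index) : set T := match i with
  | inl (inl j) => xi j @^-1` X
  | inl (inr j) => eta j @^-1` Y
  | _ => setT end.
have us2 : uniq s2.
  rewrite cat_uniq !map_inj_uniq ?us/= ?andbT; [|by move=> i j []..].
  by apply/hasPn => i /mapP[j _ ->]; apply/mapP => -[].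
have FE i : i \in s2 -> noise_sigma xi eta zeta rho i (E i).
  rewrite mem_cat => /orP[] /mapP[j _ ->] /=.
    by exists X => //; rewrite setTI.
  by exists Y => //; rewrite setTI.
have -> : \bigcap_(j in [set` s]) (xi j @^-1` X `&` eta j @^-1` Y) =
    \bigcap_(i in [set` s2]) E i.
  apply/seteqP; split => t /= st.
    by move=> i /=; rewrite mem_cat => /orP[] /mapP[j js ->] /=; case: (st j js).
  move=> j /= js; split.
    by apply: (st (inl (inl j))); rewrite /= mem_cat map_f.
  by apply: (st (inl (inr j))); rewrite /= mem_cat map_f ?orbT.
by rewrite (mutually_independent_seq noises_indep us2 FE) big_cat/= !big_map
  -big_split.
Qed.

End data_events.

Theorem theorem4p2 (R : realType) (n p N : nat) (N_ge1 : (1 <= N)%N)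
    (psi : 'cV[R]_n -> 'cV[R]_n)
    (psi_measurable : measurable_fun [set: 'cV[R]_n] psi)
    (psi_bounded : [bounded psi x | x in [set: 'cV[R]_n]])
    (H : 'M[R]_(p, n)) (Sigma0 : 'M[R]_n) (Gamma0 : 'M[R]_p) (sigma gamma : R)
    (Sigma0_posdef : posdef Sigma0) (Gamma0_posdef : posdef Gamma0)
    (sigma_gt0 : 0 < sigma) (gamma_gt0 : 0 < gamma)
    (u0 : 'cV[R]_n) (Sigma_s : 'M[R]_n) (Gamma_s : 'M[R]_p)
    (Sigma_s_psd : possemidef Sigma_s) (Gamma_s_psd : possemidef Gamma_s)
    (d : measure_display) (T : measurableType d) (P : probability T R)
    (xi : nat -> {RV P >-> 'cV[R]_n}) (eta : nat -> {RV P >-> 'cV[R]_p})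
    (zeta : nat -> 'I_N -> {RV P >-> 'cV[R]_n})
    (rho : nat -> 'I_N -> {RV P >-> R}) :
  let Sigma := sigma ^+ 2 *: Sigma0 in
  let Gamma := gamma ^+ 2 *: Gamma0 in
  (forall k, gaussian Sigma_s (distribution P (xi k))) ->
  (forall k, gaussian Gamma_s (distribution P (eta k))) ->
  (forall k i, gaussian (opf_C H Sigma Gamma) (distribution P (zeta k i))) ->
  (forall k i, uniform01 (distribution P (rho k i))) ->
  mutually_independent P (noise_sigma xi eta zeta rho) ->
  forall z z' : N.-tuple 'cV[R]_n,
  exists zN : R, 0 < zN < 1 /\
    {ae P, forall t,
      let y := observation psi H sigma gamma u0
                 (fun k => xi k t) (fun k => eta k t) in
      let q := opf_law psi H Sigma Gamma P zeta rho y in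
      (limn_esup (fun k => poweR (dTV (q z k) (q z' k)) (k%:R^-1)) <= zN%:E)%E}.
Proof.
move=> Sigma Gamma xi_g eta_g zeta_g rho_u noises_indep z z'.
have Sigma_posdef : posdef Sigma.
  exact: posdefZ (exprn_gt0 2 sigma_gt0) Sigma0_posdef.
have Gamma_posdef : posdef Gamma.
  exact: posdefZ (exprn_gt0 2 gamma_gt0) Gamma0_posdef.
pose X : set 'cV[R]_n := sup_ball (n%:R * diag_bound Sigma_s).
pose Y : set 'cV[R]_p := sup_ball (p%:R * diag_bound Gamma_s).
have mX : measurable X by exact: measurable_sup_ball.
have mY : measurable Y by exact: measurable_sup_ball.
have [M obsM] := observation_bounded H sigma gamma u0 psi_bounded
  (n%:R * diag_bound Sigma_s) (p%:R * diag_bound Gamma_s).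
have [e /andP[e0 e1] dTVe] := opf_dTV_le N_ge1 psi_measurable psi_bounded
  Sigma_posdef Gamma_posdef zeta_g rho_u noises_indep M.
pose A j := xi j @^-1` X `&` eta j @^-1` Y.
have mA j : measurable (A j).
  by apply: measurableI; exact: measurable_funPTI.
have A_indep s : uniq s ->
    P (\bigcap_(j in [set` s]) A j) = (\prod_(j <- s) P (A j))%E.
  move=> us; rewrite (data_events_indep noises_indep mX mY us).
  apply: eq_bigr => j _.
  have := data_events_indep noises_indep mX mY (isT : uniq [:: j]).
  rewrite big_seq1 => <-; congr (P _).
  by apply/seteqP; split => t /=; [apply; rewrite /= inE
    |move=> At i /=; rewrite inE => /eqP ->].
pose q := @normal_mass R ^+ n * @normal_mass R ^+ p.
have q0 : 0 < q by rewrite mulr_gt0// exprn_gt0// normal_mass_gt0.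
have PA_ge j : (q%:E <= P (A j))%E.
  have := A_indep [:: j] isT.
  rewrite (data_events_indep noises_indep mX mY (isT : uniq [:: j])) !big_seq1 => <-.
  rewrite EFinM; apply: lee_pmul.
  - by rewrite lee_fin exprn_ge0// ltW// normal_mass_gt0.
  - by rewrite lee_fin exprn_ge0// ltW// normal_mass_gt0.
  - exact: gaussian_bounded (xi_g j).
  - exact: gaussian_bounded (eta_g j).
have q1 : q <= 1 by exact: event_bound_le1 PA_ge.
have eq0 : 0 < e * q by rewrite mulr_gt0.
have eq1 : e * q < 1 by rewrite (le_lt_trans _ e1)// ler_piMr// ltW.
have ab : 1 - e * q < 1 - e * q / 2 by lra.
exists (1 - e * q / 2); split; first by apply/andP; split; lra.
have := discount_ae_le mA A_indep PA_ge e0 e1 ab.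
apply: filterS => t [K discountK] /=; set y := observation _ _ _ _ _ _ _.
apply: (limn_esup_root_le (K := K)) => [|k|k Kk]; [lra|exact: dTV_ge0|].
apply: le_trans (dTVe y z z' k) _; rewrite lee_fin.
apply: le_trans (discountK k Kk); apply: ler_prod => j _.
case: ifPn => [_|/forallPn[i yM]].
  apply/andP; split; first by rewrite subr_ge0 ltW.
  by rewrite lerB// ler_piMr ?(ltW e0)// indicE; case: (t \in A j).
have -> : \1_(A j) t = 0 :> R.
  rewrite indicE memNset// => -[At1 At2]; case/negP: yM; exact: obsM.
by rewrite subr0 mulr0 subr0 ler01 lexx.
Qed.
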